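(* There exists an absolute constant $C>0$ such that the following holds. Let $d\in\mathbb{N}$ and let $F$ be a symmetric probability distribution on $\mathbb{R}^d$ with $\operatorname{supp}F\subset\mathbb{Z}^d$ and $q:=F\{\vec 0\}\in(0,1)$. Then, for any $n\in\mathbb{N}$, $$d_{TV}\big(F^{*n},\exp(n(F-I))\big)\leq \frac{\delta^2(n/2)}{4n}\left(1+\frac{C(\delta(nq)+1)}{q^4\sqrt{n}}\right)+\frac{C(1-q)^{9/2}}{q^{5}\,n\sqrt{n}} .$$
   Context: Symmetric means $F\{\vec x\}=F\{-\vec x\}$ for all $\vec x\in\mathbb{Z}^d$. $I$ is the distribution concentrated at $\vec 0\in\mathbb{R}^d$; $*$ is convolution of finite signed measures on $\mathbb{R}^d$; $M^{*j}$ is the $j$-fold convolution power, $M^{*0}=I$; $\exp(M)=\sum_{j\ge 0}M^{*j}/j!$. Total variation distance: $d_{TV}(F,G)=\sup_B|F\{B\}-G\{B\}|=\frac12\|F-G\|_{TV}$ (supremum over Borel sets of $\mathbb{R}^d$); for measures supported on $\mathbb{Z}^d$, $\|M\|_{TV}=\sum_{\vec m\in\mathbb{Z}^d}|M\{\vec m\}|$. With $p_{\vec x}=F\{\vec x\}$, for $y>0$, $$\delta(y)=\sum_{\vec x\in \operatorname{supp}F\setminus\{\vec 0\}}\min(1,\,4y\,p_{\vec x}),$$ and $\delta^2(y)=(\delta(y))^2$. *)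

(* Defs.v *)
From HB Require Import structures.
From mathcomp Require Import all_boot all_order all_algebra.
From mathcomp Require Import all_classical all_reals all_analysis.
From mathcomp Require Import measurable_realfun.

Set Implicit Arguments.
Unset Strict Implicit.
Unset Printing Implicit Defensive.

Import Order.TTheory GRing.Theory Num.Theory.
Import numFieldNormedType.Exports.

Local Open Scope classical_set_scope.
Local Open Scope ring_scope.

(* The Borel sigma-algebra on matrices, in particular on the row vectors
   'rV[R]_d that model R^d. *)
Section borel_mx.
Context (R : realType) (m n : nat).
Let V : ptopologicalType := 'M[R]_(m, n).

HB.instance Definition _ := @isMeasurable.Build (sigma_display (@open V))
  'M[R]_(m, n) <<s (@open V) >> (@sigma_algebra0 _ setT (@open V))
  (@sigma_algebraC V (@open V)) (@sigma_algebra_bigcup _ setT (@open V)).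

End borel_mx.

Section mx_add.
Context (R : realType) (m n : nat).
Local Notation V := ('M[R]_(m, n)).

Definition mx_add (z : V * V) : V := z.1 + z.2.

Let box (ab : 'M[rat]_(m, n) * 'M[rat]_(m, n)) : set V :=
  [set x | forall i j, ratr (ab.1 i j) < x i j < ratr (ab.2 i j)].

Let open_box (U : set V) : open U ->
  U = \bigcup_ab (if pselect (box ab `<=` U) then box ab else set0).
Proof.
move=> oU; apply/seteqP; split=> [x Ux|x [ab _]]; last first.
  by case: pselect => // abU /abU.
have /nbhs_ballP[e /= e0 eU] : nbhs x U by exact: open_nbhs_nbhs.
have aP i j : {q : rat | ratr q \in `](x i j - e), (x i j)[}.
  by apply/cid; have [|q] := @rat_in_itvoo R (x i j - e) (x i j);
    [rewrite ltrBlDr ltrDl|exists q].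
have bP i j : {q : rat | ratr q \in `](x i j), (x i j + e)[}.
  by apply/cid; have [|q] := @rat_in_itvoo R (x i j) (x i j + e);
    [rewrite ltrDl|exists q].
pose ab := (\matrix_(i, j) sval (aP i j), \matrix_(i, j) sval (bP i j)).
exists ab => //.
case: pselect => /= [_|abs]; last first.
  case: abs => y yab; apply: eU; split=> // i j.
  have := yab i j; rewrite !mxE.
  have := svalP (aP i j); have := svalP (bP i j).
  rewrite !in_itv/= => /andP[_ h1] /andP[h2 _] /andP[h3 h4].
  by rewrite /ball/= distrC ltr_distl (lt_trans h2 h3) (lt_trans h4 h1).
move=> i j /=; rewrite !mxE.
have := svalP (aP i j); have := svalP (bP i j).
by rewrite !in_itv/= => /andP[-> _] /andP[_ ->].
Qed.

Lemma measurable_mx_coord i j : measurable_fun [set: V] (fun x : V => x i j).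
Proof.
apply: (measurability _ (RGenOpens.measurableE R)) => _ [_ [a [b ->] <-]].
rewrite setTI; apply: sub_sigma_algebra.
by apply: open_comp; [move=> x _; exact: coord_continuous|exact: interval_open].
Qed.

Lemma measurable_mx_add : measurable_fun [set: V * V] mx_add.
Proof.
apply: (@measurability _ _ _ _ _ _ (@open V)) => // _ [U oU <-].
rewrite setTI (open_box oU) preimage_bigcup.
apply: countable_bigcupT_measurable => // ab.
case: pselect => /= [_|_]; last by rewrite preimage_set0.
rewrite (_ : mx_add @^-1` box ab = \bigcap_(ij : 'I_m * 'I_n) ((fun z : V * V =>
    z.1 ij.1 ij.2 + z.2 ij.1 ij.2) @^-1`
    `](ratr (ab.1 ij.1 ij.2)), (ratr (ab.2 ij.1 ij.2))[%classic)); last first.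
  apply/seteqP; split=> [z zab [i j] _ /=|z zab i j].
    by have := zab i j; rewrite /mx_add mxE in_itv.
  by have := zab (i, j) I; rewrite /mx_add /= in_itv mxE.
apply: fin_bigcap_measurable => // ij _.
rewrite -[X in measurable X]setTI.
suff : measurable_fun [set: V * V] (fun z : V * V =>
    z.1 ij.1 ij.2 + z.2 ij.1 ij.2) by apply.
apply: measurable_funD.
  exact: (measurableT_comp (measurable_mx_coord _ _) measurable_fst).
exact: (measurableT_comp (measurable_mx_coord _ _) measurable_snd).
Qed.

End mx_add.

(* Finite signed measures on R^d are charges, whose values are finite. *)
Section convolution.
Context (R : realType) (d : nat).
Local Open Scope ereal_scope.
Local Notation V := ('rV[R]_d).
Implicit Types M N : {charge set V -> \bar R}.

Definition hahn_ex M : {PN : set V * set V | hahn_decomposition M PN.1 PN.2}.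
Proof.
by apply/cid; have [P [N MPN]] := Hahn_decomposition M; exists (P, N).
Qed.

Definition pospart M : {finite_measure set V -> \bar R} :=
  jordan_pos (svalP (hahn_ex M)).

Definition negpart M : {finite_measure set V -> \bar R} :=
  jordan_neg (svalP (hahn_ex M)).

Section product.
Variables mu nu : {finite_measure set V -> \bar R}.

Lemma prod_fin : fin_num_fun (mu \x nu).
Proof.
apply: lty_fin_num_fun; rewrite -setXTT [ltLHS](product_measure1E mu nu)//.
by rewrite lte_mul_pinfty// ?fin_num_measure// -ge0_fin_numE// fin_num_measure.
Qed.

Definition prod_finite := mu \x nu.

HB.instance Definition _ := Measure.on prod_finite.
HB.instance Definition _ :=
  @Measure_isFinite.Build _ _ _ prod_finite prod_fin.

Definition charge_prod_finite : {charge set (V * V)%type -> \bar R} :=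
  charge_of_finite_measure prod_finite.
End product.

(* The product of two finite signed measures, by bilinearity from their Jordan
   decompositions: M+ x N+ + M- x N- - (M+ x N- + M- x N+). *)
Definition charge_prod M N : {charge set (V * V)%type -> \bar R} :=
  cadd (cadd (charge_prod_finite (pospart M) (pospart N))
             (charge_prod_finite (negpart M) (negpart N)))
       (copp (cadd (charge_prod_finite (pospart M) (negpart N))
                   (charge_prod_finite (negpart M) (pospart N)))).

(* (M * N)(B) = (M x N){(x, y) | x + y \in B} *)
Definition convol M N : set V -> \bar R :=
  pushforward (charge_prod M N) (@mx_add R 1 d).

HB.instance Definition _ M N := Charge.copy (convol M N)
  (measure_function_pushforward__canonical__charge_Charge (charge_prod M N)
    (@measurable_mx_add R 1 d)).

Definition unit_mass : {charge set V -> \bar R} :=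
  charge_of_finite_measure (\d_ (0%R : V)).

Definition convpow M (j : nat) : {charge set V -> \bar R} :=
  iter j (fun N => convol M N : {charge set V -> \bar R}) unit_mass.

(* Setwise sum; it agrees with the sum in total variation, for which the series
   converges absolutely. *)
Definition conv_exp M : set V -> \bar R :=
  fun B => \sum_(0 <= j <oo) ((j`!%:R^-1)%R%:E * convpow M j B).

Definition dTV (mu nu : set V -> \bar R) : \bar R :=
  ereal_sup [set `|mu B - nu B| | B in (measurable : set (set V))].

End convolution.

Section lattice.
Context (R : realType) (d : nat).
Local Notation V := ('rV[R]_d).

Definition int_lattice : set V := [set x | forall i, x ord0 i \is a Num.int].

(* Topological support: the complement of the largest open null set. *)
Definition msupp (mu : set V -> \bar R) : set V :=
  [set x | forall U, open U -> U x -> (0 < mu U)%E].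

(* fine is harmless: for y >= 0 and F a probability the sum is at most 4 y. *)
Definition delta (F : set V -> \bar R) (y : R) : R :=
  fine (\esum_(x in msupp F `\ (0 : V))
    (Num.min 1 (4 * y * fine (F [set x])))%:E).

End lattice.

(* Main.v *)
(** Let T be the operator u(y) |-> E u(y + X), X ~ F, on bounded measurable functions,
    and A = T - 1, so that the two measures of B are (T^n 1_B)(0) and
    (exp(nA) 1_B)(0). Replacing exp(A) by S = (1 + A/K)^K, K -> oo, leaves only
    polynomials in T. Expanding T^n - S^n to second order around T = S, where
    S - T = A^2 H with |H| <= 1/2, gives the main term n |A^2 S^(n-1)| / 2 and a
    remainder of order n^2 |A^4 ...|.

    By symmetry A is half of the sum of p_z D_z over the atoms z, where D_z is the
    second difference in direction z. Writing F as a mixture whose one component is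
    a lazy symmetric walk in direction z, a product of two opposite lazy steps, a
    Fisher information bound for the binomial law gives |p_z D_z T^j| <= 1/((j+1) q),
    and the analogous bound without the loss in q for 1 + A/K. Summing over z
    produces delta. If delta(nq) > sqrt n the bound exceeds 1 and is trivial. *)

From HB Require Import structures.
Require Import Defs.
From mathcomp Require Import all_boot all_order all_algebra.
From mathcomp Require Import all_classical all_reals all_analysis.
From mathcomp Require Import measurable_realfun ring lra zify.

Set Implicit Arguments.
Unset Strict Implicit.
Unset Printing Implicit Defensive.

Import Order.TTheory GRing.Theory Num.Theory.
Import numFieldNormedType.Exports.
Local Open Scope classical_set_scope.
Local Open Scope ring_scope.

(** * Binomial expectations *)

(** The leading term must come out as delta^2(n/2) / (4n), so no constant may be lost in it.
    Smoothing by S^(n-1) is free of q, and writing A^2 S^(n-1) as the square of A S^((n-1)/2) costs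
    delta(Y) / (2Y) per factor with Y = (n-1)/2; this is where the argument n/2 comes from. The
    minimum in delta is the better of two bounds for p_z |D_z u|: 1/Y from smoothing and 4 p_z from
    |D_z u| <= 4. The remainder carries four factors A, each of which takes a quarter of the
    available steps, so K is a multiple of 4 to keep the exponents integral. There the steps may be
    mostly steps of T, and powers of q are lost.

    Staying with polynomials in T moves all algebra into a commutative ring. Norms enter only as
    upper bounds tested on bounded functions, so no supremum is ever formed. *)

Section binomial_expectation.
Context {R : realType}.
Implicit Types (s c : R) (M : nat) (f g : nat -> R).

(* The expectation of f under the binomial distribution B(M, s), computed by
   conditioning on the first trial. *)
Fixpoint bexp s M f : R :=
  if M is M'.+1 then (1 - s) * bexp s M' f + s * bexp s M' (f \o succn) else f 0%N.

Lemma bexpD s M f g : bexp s M (fun k => f k + g k) = bexp s M f + bexp s M g.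
Proof. by elim: M f g => //= M IH f g; rewrite !IH; ring. Qed.

Lemma bexpZ s M c f : bexp s M (fun k => c * f k) = c * bexp s M f.
Proof. by elim: M f => //= M IH f; rewrite !IH; ring. Qed.

Lemma bexp_cst s M c : bexp s M (fun=> c) = c.
Proof. by elim: M => //= M IH; rewrite IH; ring. Qed.

Lemma ler_bexp s M f g : 0 <= s <= 1 -> (forall k, f k <= g k) ->
  bexp s M f <= bexp s M g.
Proof.
move=> /andP[s0 s1]; elim: M f g => //= M IH f g fg.
by apply: lerD; apply: ler_wpM2l; rewrite ?subr_ge0//; apply: IH => k //=; exact: fg.
Qed.

(** Variance plus squared bias. The centre [c] is arbitrary because a success in the first trial
    shifts it to [c - 1]. *)
Lemma bexp_sqr_dev s M c :
  bexp s M (fun k => (k%:R - c) ^+ 2) = M%:R * s * (1 - s) + (M%:R * s - c) ^+ 2.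
Proof.
elim: M c => [|M IH] c /=; first by ring.
rewrite IH (_ : (_ \o _) = fun k => (k%:R - (c - 1)) ^+ 2); last first.
  by apply/funext => k /=; rewrite -natr1; ring.
by rewrite IH -natr1; ring.
Qed.

(** Summation by parts for the binomial law. Divided by s (1 - s), the weight on the left is the
    score, the derivative of the log-likelihood in s. *)
Lemma bexp_score s M f : bexp s M.+1 (fun k => (k%:R - M.+1%:R * s) * f k) =
  M.+1%:R * s * (1 - s) * bexp s M (fun k => f k.+1 - f k).
Proof.
elim: M f => [|M IH] f; first by rewrite /=; ring.
rewrite [LHS]/=.
(* Conditioning on the first trial leaves the weight centred for M + 2 trials; [shift] (failure) and
   [shift'] (success) recentre it for M + 1, as the induction hypothesis requires. *)
have shift g : bexp s M.+1 (fun k => (k%:R - M.+2%:R * s) * g k) =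
    bexp s M.+1 (fun k => (k%:R - M.+1%:R * s) * g k) + (- s) * bexp s M.+1 g.
  rewrite -(bexpZ s M.+1 (- s) g) -(bexpD s M.+1 (fun k => (k%:R - M.+1%:R * s) * g k)).
  by congr bexp; apply/funext => k; rewrite -[M.+2%:R]natr1; ring.
have shift' : bexp s M.+1 ((fun k => (k%:R - M.+2%:R * s) * f k) \o succn) =
    bexp s M.+1 (fun k => (k%:R - M.+1%:R * s) * f k.+1) +
    (1 - s) * bexp s M.+1 (f \o succn).
  rewrite -(bexpZ s M.+1 (1 - s)) -(bexpD s M.+1 (fun k => (k%:R - M.+1%:R * s) * f k.+1)).
  by congr bexp; apply/funext => k; rewrite /= -[M.+2%:R]natr1 -[k.+1%:R]natr1; ring.
have -> : bexp s M.+1 (fun k => f k.+1 - f k) =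
   (1 - s) * bexp s M (fun k => f k.+1 - f k) + s * bexp s M (fun k => f k.+2 - f k.+1).
  by [].
rewrite -[X in X + _ = _]/((1 - s) * bexp s M.+1 (fun k => (k%:R - M.+2%:R * s) * f k)).
rewrite -[X in _ + X = _]/(s * bexp s M.+1 ((fun k => (k%:R - M.+2%:R * s) * f k) \o succn)).
rewrite shift shift' !IH.
have : bexp s M.+1 (f \o succn) - bexp s M.+1 f = bexp s M.+1 (fun k => f k.+1 - f k).
  rewrite -[- _]mulN1r -(bexpZ s M.+1 (-1) f) -(bexpD s M.+1 (f \o succn)).
  by congr bexp; apply/funext => k /=; rewrite mulN1r.
rewrite [in X in _ = X -> _]/= => E.
rewrite -[M.+2%:R]natr1.
have -> : bexp s M.+1 (f \o succn) =
  bexp s M.+1 f + ((1 - s) * bexp s M (fun k => f k.+1 - f k) + 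
  s * bexp s M (fun k => f k.+2 - f k.+1)) by rewrite -E; ring.
by ring.
Qed.

(** The size-biased binomial law is one sure success plus the remaining trials. *)
Lemma bexp_size_bias s M f :
  bexp s M.+1 (fun k => k%:R * f k) = M.+1%:R * s * bexp s M (f \o succn).
Proof.
elim: M f => [|M IH] f; first by rewrite /=; ring.
rewrite -[LHS]/((1 - s) * bexp s M.+1 (fun k => k%:R * f k) +
   s * bexp s M.+1 ((fun k => k%:R * f k) \o succn)).
have -> : bexp s M.+1 ((fun k => k%:R * f k) \o succn) =
    bexp s M.+1 (fun k => k%:R * (f \o succn) k) + bexp s M.+1 (f \o succn).
  rewrite -(bexpD s M.+1 (fun k => k%:R * (f \o succn) k)).
  by congr bexp; apply/funext => k; rewrite /= -[k.+1%:R]natr1; ring.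
rewrite !IH -[M.+2%:R]natr1 [bexp s M.+1 (f \o succn)]/=; ring.
Qed.

(** Size biasing with f(k) = 1/k: as [0^-1 = 0], the product k f(k) is the indicator of k > 0, of
    mean at most 1. *)
Lemma bexp_inv_succ s M : 0 < s <= 1 ->
  bexp s M (fun k => k.+1%:R^-1) <= (M.+1%:R * s)^-1.
Proof.
move=> /andP[s0 s1]; have Ms : 0 < M.+1%:R * s by rewrite mulr_gt0// ltr0n.
rewrite -[leRHS]mul1r ler_pdivlMr// mulrC.
rewrite -(bexp_size_bias s M (fun k => k%:R^-1)).
rewrite -[leRHS](bexp_cst s M.+1); apply: ler_bexp => [|[|k]]; first by rewrite (ltW s0).
  by rewrite mul0r.
by rewrite mulfV.
Qed.

(* The discrete derivative is an expectation against the score, whose second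
   moment is the Fisher information. *)
Lemma bexp_diff_le s M f : 0 < s < 1 -> (forall k, `|f k| <= 1) ->
  `|bexp s M (fun k => f k.+1 - f k)| <= (Num.sqrt (M.+1%:R * (s * (1 - s))))^-1.
Proof.
move=> /andP[s0 s1] f1; set v := M.+1%:R * (s * (1 - s)).
have v0 : 0 < v by rewrite !mulr_gt0// subr_gt0.
have w0 : 0 < Num.sqrt v by rewrite sqrtr_gt0.
suff H g : (forall k, `|g k| <= 1) -> bexp s M (fun k => g k.+1 - g k) <= (Num.sqrt v)^-1.
  rewrite ler_norml H// andbT lerNl.
  suff -> : - bexp s M (fun k => f k.+1 - f k) =
    bexp s M (fun k => (fun k => - f k) k.+1 - (fun k => - f k) k).
    by apply: H => k; rewrite normrN.
  by rewrite -mulN1r -bexpZ; congr bexp; apply/funext => k; ring.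
move=> g1.
have E : v * bexp s M (fun k => g k.+1 - g k) =
    bexp s M.+1 (fun k => (k%:R - M.+1%:R * s) * g k).
  by rewrite bexp_score /v; ring.
suff : v * bexp s M (fun k => g k.+1 - g k) <= Num.sqrt v.
  rewrite -ler_pdivlMl//; move=> /le_trans; apply.
  by rewrite -{1}(sqr_sqrtr (ltW v0)) expr2 invfM -mulrA mulVf ?mulr1// gt_eqF.
rewrite E.
pose w : R := Num.sqrt v.
have wv : w ^+ 2 = v by rewrite sqr_sqrtr// ltW.
(* In place of Cauchy-Schwarz: |x| <= x^2 / (2w) + w/2, with w the standard deviation, so that both
   terms have mean w/2. *)
apply: (@le_trans _ _ (bexp s M.+1 (fun k =>
   (2 * w)^-1 * (k%:R - M.+1%:R * s) ^+ 2 + w / 2))).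
  apply: ler_bexp => [|k]; first by rewrite !ltW.
  set x := k%:R - _; have := g1 k; rewrite ler_norml => /andP[g1l g1r].
  have : 0 <= (`|x| - w) ^+ 2 by rewrite sqr_ge0.
  rewrite sqrrB real_normK ?num_real// => h.
  apply: (@le_trans _ _ `|x|).
    apply: le_trans (ler_norm _) _.
    by rewrite normrM -[leRHS]mulr1 ler_wpM2l.
  rewrite -(ler_pM2l (_ : 0 < 2 * w)) ?mulr_gt0//.
  rewrite mulrDr mulrA mulfV ?mul1r ?gt_eqF ?mulr_gt0//.
  have -> : 2 * w * (w / 2) = w ^+ 2 by field.
  rewrite -[2 * w * _]addr0; lra.
rewrite bexpD (bexpZ s M.+1 (2 * w)^-1) bexp_cst.
rewrite (bexp_sqr_dev s M.+1 (M.+1%:R * s)) subrr expr0n addr0 -mulrA -/v -/w -[X in _ * X]wv.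
by rewrite (_ : _ + _ = w)// expr2; field; rewrite gt_eqF.
Qed.

End binomial_expectation.

(** * Bounded measurable functions *)

Section bounded_measurable_functions.
Context {d : measure_display} (V : measurableType d) (R : realType).

Definition bounded_measurable : {pred V -> R} :=
  [pred f : V -> R |
    `[< measurable_fun [set: V] f /\ exists M, forall x, `|f x| <= M >]].

Fact bounded_measurable_submod : submod_closed bounded_measurable.
Proof.
split=> [|c f g /asboolP[mf [M fM]] /asboolP[mg [N gN]]]; apply/asboolP; split.
- exact: measurable_cst.
- by exists 0 => x; rewrite normr0.
- apply: measurable_funD => //; apply: measurable_funM => //.
- exists (`|c| * M + N) => x; apply: (le_trans (ler_normD _ _)).
  by rewrite lerD// normrM ler_wpM2l.
Qed.

HB.instance Definition _ := GRing.isSubmodClosed.Build R (V -> R)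
  bounded_measurable bounded_measurable_submod.

Record bmfun := BMFun { bmval :> V -> R; bmvalP : bmval \in bounded_measurable }.

HB.instance Definition _ := [isSub of bmfun for bmval].
HB.instance Definition _ := [Choice of bmfun by <:].
HB.instance Definition _ := [SubChoice_isSubLmodule of bmfun by <:].

Implicit Types u v : bmfun.

Lemma bmfunP u v : (forall x, u x = v x) -> u = v.
Proof. by move=> uv; apply: val_inj; apply/funext. Qed.

Lemma bmfunD u v x : (u + v) x = u x + v x. Proof. by []. Qed.
Lemma bmfunN u x : (- u) x = - u x. Proof. by []. Qed.
Lemma bmfunZ (c : R) u x : (c *: u) x = c * u x. Proof. by []. Qed.
Lemma bmfun0 x : (0 : bmfun) x = 0. Proof. by []. Qed.
Definition bmfunE := (bmfunD, bmfunN, bmfunZ, bmfun0).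

Lemma measurable_bmfun u : measurable_fun [set: V] u.
Proof. by have /asboolP[] := bmvalP u. Qed.

Lemma bounded_bmfun u : exists M, forall x, `|u x| <= M.
Proof. by have /asboolP[] := bmvalP u. Qed.

Definition bounded_by (a : R) u := forall x, `|u x| <= a.

Lemma bounded_byD a b u v : bounded_by a u -> bounded_by b v -> bounded_by (a + b) (u + v).
Proof. by move=> ua vb x; rewrite bmfunE (le_trans (ler_normD _ _))// lerD. Qed.

Lemma bounded_byZ a (c : R) u : bounded_by a u -> bounded_by (`|c| * a) (c *: u).
Proof. by move=> ua x; rewrite bmfunE normrM ler_wpM2l. Qed.

Lemma bounded_byN a u : bounded_by a u -> bounded_by a (- u).
Proof. by move=> ua x; rewrite bmfunE normrN. Qed.

Lemma bounded_byW a b u : a <= b -> bounded_by a u -> bounded_by b u.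
Proof. by move=> ab ua x; apply: le_trans ab. Qed.

End bounded_measurable_functions.

(** * Smoothing of second differences by lazy steps *)

Section smoothing.
Context {d : measure_display} (V : measurableType d) (R : realType).
Local Notation U := (bmfun V R).
Implicit Types (u v : U) (s p q a : R).

Lemma iter_comm (f g : U -> U) j u : (forall w, f (g w) = g (f w)) ->
  iter j f (g u) = g (iter j f u).
Proof. by move=> fg; elim: j => //= j ->. Qed.

Definition linop (f : U -> U) := forall (c : R) u v, f (c *: u + v) = c *: f u + f v.

Lemma linop0 f : linop f -> f 0 = 0.
Proof. by move=> lf; have := lf (-1) 0 0; rewrite scaleN1r oppr0 addr0 scaleN1r addNr. Qed.

Lemma linopD f : linop f -> forall u v, f (u + v) = f u + f v.
Proof. by move=> lf u v; rewrite -[u]scale1r lf !scale1r. Qed.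

Lemma linopZ f : linop f -> forall (c : R) u, f (c *: u) = c *: f u.
Proof. by move=> lf c u; rewrite -[c *: u]addr0 lf linop0// addr0. Qed.

Lemma linopN f : linop f -> forall u, f (- u) = - f u.
Proof. by move=> lf u; rewrite -scaleN1r linopZ// scaleN1r. Qed.

Lemma iter_linear f j : linop f -> linop (iter j f).
Proof. by move=> lf; elim: j => // j IH c u v; rewrite !iterS IH lf. Qed.

Lemma iter_bounded (f : U -> U) a j u :
  (forall w, bounded_by a w -> bounded_by a (f w)) ->
  bounded_by a u -> bounded_by a (iter j f u).
Proof. by move=> fa ua; elim: j => //= j IH; exact: fa. Qed.

Definition lazy s (t : U -> U) u : U := (1 - s) *: u + s *: t u.

Lemma lazy_linear s t : linop t -> linop (lazy s t).
Proof. by move=> lt c u v; apply: bmfunP => x; rewrite /lazy lt !bmfunE; ring. Qed.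

(** The binomial theorem read as probability: N lazy steps make a binomial number of real ones. *)
Lemma iter_lazyE s t N u x : linop t ->
  iter N (lazy s t) u x = bexp s N (fun k => iter k t u x).
Proof.
move=> lt; elim: N u => // N IH u; rewrite iterSr IH.
transitivity (bexp s N (fun k => (1 - s) * iter k t u x + s * iter k.+1 t u x)).
  congr bexp; apply/funext => k; have lk := iter_linear k lt.
  by rewrite /lazy (linopD lk) !(linopZ lk) !bmfunE -iterSr.
by rewrite bexpD (bexpZ s N (1 - s)) (bexpZ s N s).
Qed.

Lemma iter_lazy_diff s t N a u : linop t -> 0 < s < 1 -> 0 <= a ->
  (forall w, bounded_by a w -> bounded_by a (t w)) -> bounded_by a u ->
  bounded_by (a / Num.sqrt (N.+1%:R * (s * (1 - s))))
    (t (iter N (lazy s t) u) - iter N (lazy s t) u).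
Proof.
move=> lt s01 a0 ta ua x.
(* The case a = 0 is split off because the rest divides by a to reach [bexp_diff_le]. *)
have [a0'|an0] := eqVneq a 0.
  have z (w : U) : bounded_by a w -> forall y, w y = 0.
    by move=> wa y; apply/eqP; rewrite -normr_le0 -a0'.
  have la (w : U) : bounded_by a w -> bounded_by a (lazy s t w).
    move=> wa y; have twa := ta _ wa; rewrite /lazy !bmfunE (z _ wa) (z _ twa).
    by rewrite !mulr0 addr0 normr0.
  have ia := iter_bounded N la ua.
  by rewrite !bmfunE (z _ ia) (z _ (ta _ ia)) subrr normr0 a0' mul0r.
have ap : 0 < a by rewrite lt_def an0.
have tl w : t (lazy s t w) = lazy s t (t w) by rewrite /lazy (linopD lt) !(linopZ lt).
rewrite -(iter_comm N u (fun w => esym (tl w))) !bmfunE !iter_lazyE//.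
have -> : bexp s N (fun k => iter k t (t u) x) - bexp s N (fun k => iter k t u x) =
    a * bexp s N (fun k => iter k.+1 t u x / a - iter k t u x / a).
  rewrite -(bexpZ s N a) -[- _]mulN1r -(bexpZ s N (-1)) -(bexpD s N).
  by congr bexp; apply/funext => k; rewrite -iterSr; field.
rewrite normrM gtr0_norm// ler_pM2l//.
apply: (bexp_diff_le N (f := fun k => iter k t u x / a)) => // k.
by rewrite normrM normfV (gtr0_norm ap) ler_pdivrMr// mul1r; exact: iter_bounded.
Qed.

(* T is the mixture r B + S, where r = q + 2 p and B = W W' is the product of the
   lazy steps in the two opposite directions, with s (1 - s) = p / r. *)
Lemma second_diff_le T t t' p q j a u : linop T -> linop t -> linop t' ->
  0 < p -> p <= q / 2 -> q + 2 * p <= 1 -> 0 <= a ->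
  (forall w, t (t' w) = w) -> (forall w, t' (t w) = w) ->
  (forall w, T (t w) = t (T w)) -> (forall w, T (t' w) = t' (T w)) ->
  (forall b w, bounded_by b w -> bounded_by b (t w)) ->
  (forall b w, bounded_by b w -> bounded_by b (t' w)) ->
  (forall b w, bounded_by b w ->
    bounded_by ((1 - q - 2 * p) * b) (T w - q *: w - p *: (t w + t' w))) ->
  bounded_by a u ->
  bounded_by (a / (j.+1%:R * p)) (iter j T (t u + t' u - 2 *: u)).
Proof.
move=> lT lt lt' p0 pq r1 a0 tt' t't Tt Tt' tb t'b Sb ua.
set r := q + 2 * p in r1.
have q0 : 0 < q by lra.
have r0 : 0 < r by rewrite /r; lra.
pose c := p / r.
have c0 : 0 < c by rewrite divr_gt0.
have c4 : c <= 1 / 4 by rewrite ler_pdivrMr// /r; lra.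
(* The smaller root of s (1 - s) = c, real because p <= q / 2 gives c <= 1/4. *)
pose s := (1 - Num.sqrt (1 - 4 * c)) / 2.
have sc : s * (1 - s) = c.
  have : Num.sqrt (1 - 4 * c) ^+ 2 = 1 - 4 * c by rewrite sqr_sqrtr//; lra.
  by rewrite /s; set z := Num.sqrt _; nra.
have s0 : 0 < s.
  rewrite /s divr_gt0// subr_gt0 -[ltRHS]sqrtr1 ltr_sqrt//; lra.
have s1 : s < 1.
  have : 0 <= Num.sqrt (1 - 4 * c) by rewrite sqrtr_ge0.
  by rewrite /s; lra.
have s01 : 0 < s < 1 by rewrite s0.
pose W := lazy s t; pose W' := lazy s t'.
have tW w : t' (W w) = W (t' w).
  by rewrite /W /lazy (linopD lt') !(linopZ lt') t't tt'.
have linE := (linopD lt, linopD lt', linopZ lt, linopZ lt', linopN lt, linopN lt').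
clearbody s.
have WW' w : W (W' w) = W' (W w).
  by apply: bmfunP => x; rewrite /W /W' /lazy !linE tt' t't !bmfunE; ring.
have TW w : T (W w) = W (T w) by rewrite /W /lazy (linopD lT) !(linopZ lT) Tt.
have TW' w : T (W' w) = W' (T w) by rewrite /W' /lazy (linopD lT) !(linopZ lT) Tt'.
pose B w := W (W' w); pose D w : U := t w + t' w - 2 *: w.
(* W W' has weight (1 - s)^2 + s^2 = 1 - 2c = q/r at the identity and c = p/r at each of t and
   t'. *)
have BE w : r *: B w = q *: w + p *: (t w + t' w).
  have pE : p = r * (s * (1 - s)) by rewrite sc /c; field; rewrite gt_eqF.
  have qE : q = r - 2 * (r * (s * (1 - s))) by rewrite -pE /r; ring.
  apply: bmfunP => x; rewrite /B /W /W' /lazy !linE tt' !bmfunE.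
  by rewrite qE pE; ring.
have BD w : B (D w) = D (B w).
  apply: bmfunP => x; rewrite /B /D /W /W' /lazy !linE !tt' !t't !bmfunE.
  by ring.
have BT w : T (B w) = B (T w) by rewrite /B TW TW'.
have iterBE N w : iter N B w = iter N W (iter N W' w).
  elim: N w => // N IH w; rewrite iterS IH /B; congr (W _).
  by rewrite -(iter_comm N _ WW').
(* Since t t' = 1, D = - (t - 1) (t' - 1). One factor goes with W^N, the other with W'^N, and each
   costs 1 / sqrt((N + 1) c). *)
have Dv N : bounded_by (a * (N.+1%:R * c)^-1) (D (iter N B u)).
  set k := Num.sqrt (N.+1%:R * c).
  have Nc0 : 0 < N.+1%:R * c by rewrite mulr_gt0// ltr0n.
  have k0 : 0 < k by rewrite sqrtr_gt0.
  have kk : k * k = N.+1%:R * c by rewrite -expr2 sqr_sqrtr// ltW.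
  pose y := t' (iter N W' u) - iter N W' u.
  have yb : bounded_by (a / k) y.
    by rewrite /k -sc; apply: iter_lazy_diff => //; exact: t'b.
  have -> : D (iter N B u) = - (t (iter N W y) - iter N W y).
    have -> : iter N W y = t' (iter N B u) - iter N B u.
      have /(_ (-1) (iter N W' u) (t' (iter N W' u))) := iter_linear N (lazy_linear s lt).
      rewrite !scaleN1r addrC => ->; rewrite -/W iterBE addrC; congr (_ - _).
      by rewrite (iter_comm N _ (fun w => esym (tW w))).
    by apply: bmfunP => x; rewrite !linE tt' /D !bmfunE; ring.
  apply: bounded_byN.
  have -> : a * (N.+1%:R * c)^-1 = a / k / k by rewrite -kk invfM mulrA.
  by rewrite {2}/k -sc; apply: iter_lazy_diff => //; [rewrite divr_ge0// ltW|exact: tb].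
(* Each T is (T - r B) + r B, the first part of norm at most 1 - r. Expanding i of them produces a
   binomial number of factors B, on top of the N already collected. *)
have main i N : bounded_by (a * bexp r i (fun k => ((N + k).+1%:R * c)^-1))
    (iter i T (D (iter N B u))).
  elim: i N => [|i IH] N; first by rewrite /= addn0; exact: Dv.
  rewrite iterS; set w := iter i T _.
  have -> : T w = (T w - q *: w - p *: (t w + t' w)) + r *: B w.
    by rewrite BE; apply: bmfunP => x; rewrite !bmfunE; ring.
  have -> : B w = iter i T (D (iter N.+1 B u)).
    by rewrite /w -(iter_comm i _ BT) BD -iterS.
  rewrite [bexp _ _ _]/= mulrDr; apply: bounded_byD.
    rewrite mulrCA (_ : 1 - r = 1 - q - 2 * p); last by rewrite /r; ring.
    exact/Sb/IH.
  rewrite mulrCA -{1}(gtr0_norm r0); apply: bounded_byZ.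
  have := IH N.+1; congr (bounded_by (_ * bexp _ _ _) _).
  by apply/funext => k /=; rewrite addnS.
(* The mean of 1/(k + 1) under the binomial law is at most 1/((j + 1) r), and r c = p. *)
have := main j 0%N; apply: bounded_byW; apply: ler_wpM2l => //.
rewrite (_ : (fun k => _) = fun k => c^-1 * k.+1%:R^-1); last first.
  by apply/funext => k; rewrite add0n invfM mulrC.
rewrite (bexpZ r j c^-1).
have -> : (j.+1%:R * p)^-1 = c^-1 * (j.+1%:R * r)^-1.
  by rewrite -invfM; congr (_^-1); rewrite /c; field; rewrite gt_eqF.
by apply: ler_wpM2l; [rewrite invr_ge0 ltW | apply: bexp_inv_succ; rewrite r0].
Qed.
End smoothing.

(** * Polynomials in an operator *)

(** Second-order Taylor expansion of the power at [y]. The remainder stays a weighted sum of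
    monomials, so that it can be bounded term by term. *)
Lemma subrXX_second (A : comRingType) (x y : A) n :
  x ^+ n.+1 - y ^+ n.+1 = (x - y) * y ^+ n *+ n.+1 +
    (x - y) ^+ 2 * \sum_(j < n) (x ^+ j * y ^+ (n.-1 - j)) *+ (n - j).
Proof.
elim: n => [|n IH]; first by rewrite big_ord0 !expr1 expr0; ring.
have -> : x ^+ n.+2 - y ^+ n.+2 = x * (x ^+ n.+1 - y ^+ n.+1) + (x - y) * y ^+ n.+1.
  by rewrite !exprS; ring.
rewrite IH big_ord_recl /= expr0 mul1r !subn0.
have -> : \sum_(i < n) (x ^+ bump 0 i * y ^+ (n - bump 0 i)) *+ (n.+1 - bump 0 i) =
    x * \sum_(i < n) (x ^+ i * y ^+ (n.-1 - i)) *+ (n - i).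
  rewrite mulr_sumr; apply: eq_bigr => i _.
  rewrite /bump /= add1n subSS exprS -mulrA -mulrnAr.
  by rewrite (_ : (n - i.+1 = n.-1 - i)%N)// subnS -subn1 subnAC subn1.
set Q := \sum_(i < n) _.
by rewrite [in RHS]mulrSr -[_ *+ n.+1]mulr_natr !exprS; ring.
Qed.

Section polynomial_calculus.
Context {d : measure_display} (V : measurableType d) (R : realType).
Local Notation U := (bmfun V R).
Variable T : U -> U.
Implicit Types (P Q : {poly R}) (u v : U) (a b c : R).

Definition lazy_poly (K : nat) : {poly R} := 1 + K%:R^-1 *: ('X - 1).

(** Evaluation of a polynomial at the operator [T]. Operator identities become polynomial
    identities, within reach of [ring]. *)
Definition act P u : U := \sum_(i < size P) P`_i *: iter i T u.

Lemma act_widen n P u : (size P <= n)%N -> act P u = \sum_(i < n) P`_i *: iter i T u.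
Proof.
move=> Pn; rewrite /act (big_ord_widen _ (fun i => P`_i *: iter i T u) Pn).
rewrite big_mkcond; apply: eq_bigr => i _; case: ltnP => // Pi.
by rewrite nth_default// scale0r.
Qed.

Lemma actD P Q u : act (P + Q) u = act P u + act Q u.
Proof.
set n := maxn (size P) (size Q).
rewrite !(@act_widen n) ?leq_maxl ?leq_maxr ?size_polyD//.
by rewrite -big_split; apply: eq_bigr => i _; rewrite coefD scalerDl.
Qed.

Lemma actZ c P u : act (c *: P) u = c *: act P u.
Proof.
rewrite (@act_widen (size P)) ?size_scale_leq// scaler_sumr.
by apply: eq_bigr => i _; rewrite coefZ scalerA.
Qed.

Lemma actN P u : act (- P) u = - act P u.
Proof. by rewrite -scaleN1r actZ scaleN1r. Qed.

Lemma actC c u : act c%:P u = c *: u.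
Proof. by rewrite (@act_widen 1) ?size_polyC_leq1// big_ord1 coefC. Qed.

Lemma act1 u : act 1 u = u. Proof. by rewrite actC scale1r. Qed.

Lemma actMX P u : act (P * 'X) u = act P (T u).
Proof.
rewrite (@act_widen (size P).+1); last first.
  by rewrite (leq_trans (size_polyMleq _ _))// size_polyX addn2.
rewrite big_ord_recl coefMX /= scale0r add0r.
by apply: eq_bigr => i _; rewrite coefMX /= -iterS iterSr.
Qed.

Lemma actX u : act 'X u = T u.
Proof. by rewrite -[X in act X]mul1r actMX act1. Qed.

Lemma actXn n u : act ('X ^+ n) u = iter n T u.
Proof.
elim: n u => [|n IH] u; first by rewrite expr0 act1.
by rewrite exprSr actMX IH iterSr.
Qed.

Hypothesis lT : linop T.

Lemma act_linear P : linop (act P).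
Proof.
move=> c u v; rewrite /act scaler_sumr -big_split; apply: eq_bigr => i _ /=.
by rewrite (iter_linear i lT) scalerDr !scalerA mulrC.
Qed.

Lemma actM P Q u : act (P * Q) u = act P (act Q u).
Proof.
elim/poly_ind: Q u => [|Q c IH] u.
  by rewrite mulr0 !actC !scale0r (linop0 (act_linear P)).
rewrite mulrDr actD mulrA actMX IH actD actC (linopD (act_linear P)) actMX.
by rewrite [P * _]mulrC mul_polyC actZ (linopZ (act_linear P)).
Qed.

Lemma actXp P n u : act (P ^+ n) u = iter n (act P) u.
Proof. by elim: n => [|n IH]; rewrite ?expr0 ?act1// exprS actM IH. Qed.

Hypothesis bT : forall a u, bounded_by a u -> bounded_by a (T u).

Definition opnorm_le c P :=
  forall a u, 0 <= a -> bounded_by a u -> bounded_by (c * a) (act P u).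

Lemma opnormW c c' P : c <= c' -> opnorm_le c P -> opnorm_le c' P.
Proof. by move=> cc' cP a u a0 ua; apply: bounded_byW (cP _ _ a0 ua); rewrite ler_wpM2r. Qed.

Lemma opnormD c c' P Q : opnorm_le c P -> opnorm_le c' Q -> opnorm_le (c + c') (P + Q).
Proof.
by move=> cP cQ a u a0 ua; rewrite actD mulrDl; apply: bounded_byD; [exact: cP|exact: cQ].
Qed.

Lemma opnormZ c k P : 0 <= k -> opnorm_le c P -> opnorm_le (k * c) (k *: P).
Proof.
move=> k0 cP a u a0 ua; rewrite actZ -mulrA -{1}(ger0_norm k0).
by apply: bounded_byZ; exact: cP.
Qed.

Lemma opnormMn c n P : opnorm_le c P -> opnorm_le (n%:R * c) (P *+ n).
Proof. by move=> cP; rewrite -[P *+ n]scaler_nat; exact: opnormZ. Qed.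

Lemma opnormN c P : opnorm_le c P -> opnorm_le c (- P).
Proof. by move=> cP a u a0 ua; rewrite actN; apply: bounded_byN; exact: cP. Qed.

Lemma opnormM c c' P Q : 0 <= c' ->
  opnorm_le c P -> opnorm_le c' Q -> opnorm_le (c * c') (P * Q).
Proof.
move=> c0 cP cQ a u a0 ua; rewrite actM -mulrA; apply: cP; last exact: cQ.
by rewrite mulr_ge0.
Qed.

Lemma opnorm1 : opnorm_le 1 1.
Proof. by move=> a u a0 ua; rewrite act1 mul1r. Qed.

Lemma opnorm0 : opnorm_le 0 0.
Proof. by move=> a u a0 ua x; rewrite actC scale0r bmfunE normr0 mul0r. Qed.

Lemma opnormX : opnorm_le 1 'X.
Proof. by move=> a u a0 ua; rewrite actX mul1r; exact: bT. Qed.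

Lemma opnorm_exp c n P : 0 <= c -> opnorm_le c P -> opnorm_le (c ^+ n) (P ^+ n).
Proof.
move=> c0 cP; elim: n => [|n IH]; first exact: opnorm1.
by rewrite !exprS; apply: opnormM => //; rewrite exprn_ge0.
Qed.

Lemma opnorm_exp1 n P : opnorm_le 1 P -> opnorm_le 1 (P ^+ n).
Proof. by move=> cP; rewrite -(expr1n _ n); exact: opnorm_exp. Qed.

Lemma opnorm_sum n (c : 'I_n -> R) (P : 'I_n -> {poly R}) :
  (forall i, opnorm_le (c i) (P i)) -> opnorm_le (\sum_(i < n) c i) (\sum_(i < n) P i).
Proof.
move=> cP; elim/big_ind2: _ => //; [exact: opnorm0|by move=> *; exact: opnormD].
Qed.

Local Notation A := ('X - 1 : {poly R}).

Lemma opnorm_lazy_poly K : (0 < K)%N -> opnorm_le 1 (lazy_poly K).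
Proof.
move=> K0; have K1 : K%:R^-1 <= 1 :> R by rewrite invf_le1 ?ltr0n// ler1n.
have -> : lazy_poly K = (1 - K%:R^-1) *: 1 + K%:R^-1 *: 'X :> {poly R}.
  by rewrite /lazy_poly scalerBr scalerBl scale1r; ring.
rewrite -[X in opnorm_le X](subrK K%:R^-1); apply: opnormD.
  by rewrite -{1}[_ - _]mulr1; apply: opnormZ; [rewrite subr_ge0|exact: opnorm1].
by rewrite -{1}[_^-1]mulr1; apply: opnormZ; [rewrite invr_ge0|exact: opnormX].
Qed.

(** Write G for [lazy_poly K]. The second-order remainders of G^m satisfy H_(m+1) = G H_m + m, and
    |G| <= 1 gives |H_m| <= m^2 / 2; then m = K is divided by K^2. *)
Lemma lazy_poly_exp_second K : (0 < K)%N ->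
  exists2 H, opnorm_le (1 / 2) H & lazy_poly K ^+ K = 1 + A + A ^+ 2 * H.
Proof.
move=> K0; have K0' : K%:R != 0 :> R by rewrite pnatr_eq0 -lt0n.
suff /(_ K)[H H2 HE] : forall m, exists2 H, opnorm_le (m%:R ^+ 2 / 2) H &
    lazy_poly K ^+ m = 1 + (m%:R / K%:R) *: A + K%:R ^- 2 *: (A ^+ 2 * H).
  exists (K%:R ^- 2 *: H); last by rewrite HE divff// scale1r scalerAr.
  rewrite (_ : 1 / 2 = K%:R ^- 2 * (K%:R ^+ 2 / 2)); last by field.
  by apply: opnormZ => //; rewrite invr_ge0 sqr_ge0.
elim=> [|m [H H2 HE]].
  exists 0; first by rewrite expr0n /= mul0r; exact: opnorm0.
  by rewrite mul0r scale0r mulr0 scaler0 !addr0.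
exists (lazy_poly K * H + m%:R *: 1).
  apply: (@opnormW (1 * (m%:R ^+ 2 / 2) + m%:R * 1)).
    by rewrite -[m.+1%:R]natr1 sqrrD; lra.
  apply: opnormD; last by apply: opnormZ => //; exact: opnorm1.
  apply: opnormM; first by rewrite divr_ge0// sqr_ge0.
    exact: opnorm_lazy_poly.
  exact: H2.
rewrite exprS HE /lazy_poly -[m.+1%:R]natr1 -!mul_polyC.
set k : {poly R} := (K%:R^-1)%:P.
have kE : (K%:R ^- 2)%:P = k ^+ 2 by rewrite -exprVn rmorphXn.
have mE l : (l / K%:R)%:P = l%:P * k by rewrite polyCM.
by rewrite kE !mE polyCD; ring.
Qed.

(* With S = G ^+ K = 1 + A + A^2 H, the difference 'X - S is - A^2 H. *)
Lemma opnorm_subX_lazy_poly K n b c : (0 < K)%N ->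
  opnorm_le b (A ^+ 2 * lazy_poly K ^+ (K * n)) -> 
  (forall j, (j < n)%N ->
    opnorm_le c (A ^+ 4 * ('X ^+ j * lazy_poly K ^+ (K * (n.-1 - j))))) ->
  0 <= b -> 0 <= c ->
  opnorm_le (n.+1%:R * (b / 2) + n.+1%:R ^+ 2 * (c / 4))
    ('X ^+ n.+1 - lazy_poly K ^+ (K * n.+1)).
Proof.
move=> K0 hb hc b0 c0.
have [H H2 HE] := lazy_poly_exp_second K0.
rewrite exprM subrXX_second.
have XS : 'X - lazy_poly K ^+ K = - (A ^+ 2 * H) by rewrite HE; ring.
rewrite XS; apply: opnormD.
  apply: opnormMn; rewrite mulNr; apply: opnormN.
  rewrite mulrAC -exprM -[2^-1]mul1r.
  by apply: opnormM hb H2; rewrite mul1r invr_ge0.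
rewrite sqrrN mulr_sumr.
(* Each weight [n - j] is bounded by n, and H^2 contributes the factor 1/4. *)
apply: (@opnormW (\sum_(j < n) n%:R * (c * (1 / 2 * (1 / 2))))).
  rewrite (_ : 1 / 2 * (1 / 2) = 4^-1); last by field.
  rewrite sumr_const card_ord -[_ *+ n]mulr_natl mulrA -expr2.
  apply: ler_wpM2r; first by rewrite divr_ge0.
  by rewrite ler_sqr ?nnegrE// ler_nat.
apply: opnorm_sum => j.
apply: (@opnormW ((n - j)%N%:R * (c * (1 / 2 * (1 / 2))))).
  apply: ler_wpM2r; last by rewrite ler_nat leq_subr.
  by rewrite mulr_ge0// mulr_ge0// divr_ge0.
rewrite -exprM mulrnAr; apply: opnormMn.
rewrite (_ : (_ * H) ^+ 2 * _ =
    A ^+ 4 * ('X ^+ j * lazy_poly K ^+ (K * (n.-1 - j))) * (H * H)); last by ring.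
by apply: opnormM; [rewrite mulr_ge0// divr_ge0|exact: hc|apply: opnormM => //; rewrite divr_ge0].
Qed.

End polynomial_calculus.

(** * Approximation of the exponential *)

Lemma leq_ffact_expn M j : (M ^_ j <= M ^ j)%N.
Proof.
elim: j => [|j IH]; first by rewrite ffactn0.
by rewrite ffactnSr expnSr leq_mul// leq_subr.
Qed.

(** The birthday bound: among j draws from M values, some pair coincides with probability at most
    'C(j, 2) / M. The factor [M] clears the denominator. *)
Lemma leq_expn_ffact M j : (M * M ^ j <= M * M ^_ j + 'C(j, 2) * M ^ j)%N.
Proof.
elim: j => [|j IH]; first by rewrite ffactn0 expn0 bin0n addn0.
rewrite binS bin1 ffactnSr expnS mulnDl.
have h : (M * M ^_ j <= M ^_ j * (M - j) + j * M ^ j)%N.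
  have := leq_ffact_expn M j.
  have [jM|Mj] := leqP j M.
    by move=> ?; rewrite -{1}(subnK jM) mulnDl mulnC leq_add2l leq_mul.
  rewrite ffact_small// muln0; lia.
apply: (leq_trans (leq_mul (leqnn M) IH)).
rewrite mulnDr.
apply: (leq_trans (leq_add (leq_mul (leqnn M) h) (leqnn _))).
by rewrite mulnDr; lia.
Qed.

Lemma bin2_leq_exp j : ('C(j, 2) <= 2 ^ j)%N.
Proof.
elim: j => // j IH; rewrite binS bin1 expnS mul2n -addnn leq_add//.
exact: ltnW (ltn_expl _ _).
Qed.

Section exponential_limit.
Context {R : realType}.
Implicit Types (b : nat -> R) (x l B : R).

(** Compares the coefficients of A^j in exp(nA) and in (1 + A/K)^(nK). The relative error is at most
    'C(j, 2) / (nK), hence at most 2^j / K. *)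
Lemma bin_exp_coeff_le n K j : (0 < n)%N -> (0 < K)%N ->
  `|n%:R ^+ j / j`!%:R - 'C(n * K, j)%:R / K%:R ^+ j| <=
  n%:R ^+ j / j`!%:R * 2 ^+ j / K%:R :> R.
Proof.
move=> n0 K0; set M := (n * K)%N.
have K0' : 0 < K%:R :> R by rewrite ltr0n.
have j0 : 0 < j`!%:R :> R by rewrite ltr0n fact_gt0.
have vE : n%:R ^+ j / j`!%:R = (M ^ j)%:R / (K%:R ^+ j * j`!%:R) :> R.
  rewrite natrX natrM exprMn; field.
  by rewrite !gt_eqF// exprn_gt0.
have uE : 'C(M, j)%:R / K%:R ^+ j = (M ^_ j)%:R / (K%:R ^+ j * j`!%:R) :> R.
  rewrite -bin_ffact natrM; field.
  by rewrite !gt_eqF// exprn_gt0.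
rewrite vE uE -mulrBl ger0_norm; last first.
  by rewrite divr_ge0 ?subr_ge0 ?ler_nat ?leq_ffact_expn// mulr_ge0 ?exprn_ge0// ltW.
rewrite mulrAC -mulrA mulrAC; apply: ler_wpM2r.
  by rewrite invr_ge0 mulr_ge0// ?exprn_ge0// ltW.
have M0 : 0 < M%:R :> R by rewrite ltr0n muln_gt0 n0.
rewrite -(ler_pM2l M0) mulrBr.
apply: (@le_trans _ _ ('C(j, 2) * M ^ j)%:R).
  by rewrite lerBlDl -natrM -natrM -natrD ler_nat leq_expn_ffact.
rewrite natrM mulrC (_ : M%:R * _ = (M ^ j)%:R * (2 ^+ j * n%:R)); last first.
  by rewrite /M natrM; field; rewrite gt_eqF.
apply: ler_wpM2l => //; rewrite -natrX -natrM ler_nat.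
by rewrite (leq_trans (bin2_leq_exp j))// leq_pmulr.
Qed.

Lemma exp_partial_sum_le (y : R) m : 0 <= y ->
  \sum_(0 <= j < m) y ^+ j / j`!%:R <= expR y.
Proof.
move=> y0; have := @is_cvg_series_exp_coeff R y => cv.
apply: (@nondecreasing_cvgn_le R (series (exp_coeff y))) => //.
apply/nondecreasing_seqP => k; rewrite /series/= big_nat_recr//= lerDl.
by rewrite divr_ge0 ?exprn_ge0.
Qed.

(** The passage K -> oo, used with [b j] = (A^j 1_B)(0) and [x] = (T^n 1_B)(0). Multiples of 4
    suffice, as they are unbounded. *)
Lemma exp_limit_bound n b x l B : (0 < n)%N -> (forall j, `|b j| <= 2 ^+ j) ->
  series (fun j => n%:R ^+ j / j`!%:R * b j) @ \oo --> l ->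
  (forall K, (0 < K)%N -> (4 %| K)%N ->
     `|x - \sum_(j < (n * K).+1) 'C(n * K, j)%:R / K%:R ^+ j * b j| <= B) ->
  `|x - l| <= B.
Proof.
move=> n0 b2 cl xB; apply/ler_addgt0Pr => e e0.
(* In 4n one factor 2 comes from [bin_exp_coeff_le] and the other from the bound on [b]. *)
set E := expR (4 * n%:R : R).
have [k kE] : exists k : nat, E / e < k%:R.
  exists (Num.bound (E / e)); exact: archi_boundP (divr_ge0 (expR_ge0 _) (ltW e0)).
pose K := (4 * k.+1)%N.
have K0 : (0 < K)%N by [].
have EK : E / K%:R <= e.
  rewrite ler_pdivrMr ?ltr0n// mulrC -ler_pdivrMr// (le_trans (ltW kE))// ler_nat.
  by rewrite /K; lia.
have cx : (fun m => x - series (fun j => n%:R ^+ j / j`!%:R * b j) m) @ \oo --> x - l.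
  by apply: cvgB => //; exact: cvg_cst.
have cx' : (fun m => `|x - series (fun j => n%:R ^+ j / j`!%:R * b j) m|) @ \oo --> `|x - l|.
  exact: cvg_norm.
rewrite -(cvg_lim _ cx')//; apply: limr_le; first by apply/cvg_ex; exists `|x - l|.
(* Beyond nK the binomial coefficients vanish, so both sums may run up to m. *)
exists (n * K).+1 => // m /= mK.
have := xB K K0 (dvdn_mulr _ _).
have -> : \sum_(j < (n * K).+1) 'C(n * K, j)%:R / K%:R ^+ j * b j =
   \sum_(0 <= j < m) 'C(n * K, j)%:R / K%:R ^+ j * b j.
  rewrite -(big_mkord xpredT (fun j => 'C(n * K, j)%:R / K%:R ^+ j * b j)).
  rewrite (big_cat_nat _ mK)//= [X in _ = _ + X]big_nat_cond.
  rewrite [X in _ = _ + X]big1 ?addr0// => i.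
  by rewrite andbT => /andP[iK _]; rewrite bin_small// !mul0r.
move=> /(_ isT) h; rewrite /series/=.
apply: (@le_trans _ _ (B + E / K%:R)); last by rewrite lerD2l.
rewrite -[X in x - X](subrK (\sum_(0 <= j < m) 'C(n * K, j)%:R / K%:R ^+ j * b j)).
rewrite opprD addrCA addrC (le_trans (ler_normD _ _))// lerD// normrN -sumrB.
apply: (le_trans (ler_norm_sum _ _ _)).
apply: (@le_trans _ _ (\sum_(0 <= j < m) (4 * n%:R) ^+ j / j`!%:R / K%:R)); last first.
  by rewrite -mulr_suml ler_wpM2r ?invr_ge0// exp_partial_sum_le// mulr_ge0.
apply: ler_sum => j _; rewrite -mulrBl normrM.
apply: (le_trans (ler_pM _ _ (bin_exp_coeff_le j n0 K0) (b2 j))) => //.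
rewrite (_ : 4 = 2 * 2) ?exprMn; last by ring.
rewrite le_eqVlt; apply/orP; left; apply/eqP; field; rewrite !gt_eqF ?ltr0n ?fact_gt0//.
Qed.

End exponential_limit.

(** * The lattice in Euclidean space *)

Section euclidean_space.
Context (R : realType) (d : nat).
Local Notation V := ('rV[R]_d).

Lemma open_measurable_rV (U : set V) : open U -> measurable U.
Proof. by move=> oU; exact: sub_sigma_algebra. Qed.

Lemma measurable_set1_rV (x : V) : measurable [set x].
Proof.
rewrite -[X in measurable X]setCK; apply: measurableC; apply: open_measurable_rV.
by apply: closed_openC; apply: accessible_closed_set1; exact/hausdorff_accessible/norm_hausdorff.
Qed.

Lemma continuous_measurable_rV (f : V -> V) :
  (forall x, continuous_at x f) -> measurable_fun [set: V] f.
Proof.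
move=> cf; apply: (@measurability _ _ _ _ _ _ (@open V)) => // _ [U oU <-].
by rewrite setTI; apply: open_measurable_rV; apply: open_comp => // x _; exact: cf.
Qed.

Lemma measurable_opp_rV : measurable_fun [set: V] (fun x => - x).
Proof. by apply: continuous_measurable_rV => x; exact: opp_continuous. Qed.

Lemma measurable_addl_rV (y : V) : measurable_fun [set: V] (fun x => y + x).
Proof.
apply: continuous_measurable_rV => x.
by apply: (@continuousD _ _ _ (cst y) id); [exact: cst_continuous|].
Qed.

(** A Lindelof argument: each point outside the support lies in a null ball with rational centre and
    radius 1/(k + 1), and such balls are countably many. *)
Lemma support_compl_null (mu : {measure set V -> \bar R}) :
  mu.-negligible (~` msupp mu).
Proof.
pose B (c : 'rV[rat]_d) (k : nat) : set V := ball (map_mx ratr c : V) k.+1%:R^-1.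
pose B0 i := if @pickle_inv ('rV[rat]_d * nat)%type i is Some (c, k) then
  (if pselect (mu (B c k) = 0%E) then B c k else set0) else set0.
have mB c k : measurable (B c k) by apply: open_measurable_rV; exact: ball_open.
apply: (@negligibleS _ _ _ _ (\bigcup_i B0 i)); last first.
  apply: negligible_bigcup => i; rewrite /B0.
  case: (pickle_inv i) => [[c k]|]; last exact: negligible_set0.
  case: pselect => [Bck|Bck]; last exact: negligible_set0.
  by apply/negligibleP.
move=> x /existsNP[U /not_implyP[oU /not_implyP[Ux /negP]]].
rewrite -leNgt => U0.
have /nbhs_ballP[e /= e0 eU] : nbhs x U by exact: open_nbhs_nbhs.
have [k ke] : exists k, k.+1%:R^-1 < e / 2.
  exists (Num.bound (2 / e)); rewrite -[e / 2]invrK ltf_pV2 ?posrE ?invr_gt0 ?divr_gt0//.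
  rewrite invf_div; apply: (lt_le_trans (archi_boundP _)).
    by rewrite divr_ge0// ltW.
  by rewrite ler_nat.
have k0 : 0 < k.+1%:R^-1 :> R by rewrite invr_gt0.
have cP i j : {r : rat | ratr r \in `](x i j - k.+1%:R^-1), (x i j)[}.
  by apply/cid; have [|r] := @rat_in_itvoo R (x i j - k.+1%:R^-1) (x i j);
    [rewrite ltrBlDr ltrDl|exists r].
pose c := \row_j sval (cP ord0 j).
have Bx : B c k x.
  split=> // i j; rewrite !mxE (ord1 i); have := svalP (cP ord0 j).
  rewrite in_itv/= => /andP[h1 h2]; rewrite /ball/= ltr_distl h1/=.
  by rewrite (lt_trans h2)// ltrDl.
exists (pickle (c, k)) => //; rewrite /B0 pickleK_inv.
case: pselect => // abs; exfalso; apply: abs; apply/eqP.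
rewrite eq_le measure_ge0 andbT (le_trans _ U0)//.
apply: le_measure; rewrite ?inE//; first exact: open_measurable_rV.
move=> y By; apply: eU.
apply: (@le_ball _ _ _ (k.+1%:R^-1 + k.+1%:R^-1)); first by rewrite [leRHS]splitr lerD// ltW.
by apply: ball_triangle By; exact: ball_sym.
Qed.

Definition lattice_pt (z : 'rV[int]_d) : V := map_mx intr z.

Lemma int_latticeE : @int_lattice R d = range lattice_pt.
Proof.
apply/seteqP; split=> [x xL|_ [z _ <-] i]; last by rewrite mxE intr_int.
exists (map_mx Num.floor x) => //; apply/rowP => i; rewrite !mxE.
by apply/eqP; rewrite -intrEfloor; exact: xL.
Qed.

(** Enumerates the lattice by codes, with empty blocks at naturals that code nothing, so that
    integrals over the lattice become series over nat. *)
Definition lattice_block (k : nat) : set V :=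
  if pickle_inv k is Some z then [set lattice_pt z] else set0.

Lemma bigcup_lattice_block : \bigcup_k lattice_block k = @int_lattice R d.
Proof.
rewrite int_latticeE; apply/seteqP; split=> [x [k _]|_ [z _ <-]].
  by rewrite /lattice_block; case: pickle_inv => // z ->; exists z.
by exists (pickle z) => //; rewrite /lattice_block pickleK_inv.
Qed.

Lemma lattice_pt_inj : injective lattice_pt.
Proof. by move=> y z /rowP yz; apply/rowP => i; have := yz i; rewrite !mxE => /intr_inj. Qed.

Lemma trivIset_lattice_block : trivIset setT lattice_block.
Proof.
move=> k l _ _ [x []]; rewrite /lattice_block.
case kz : (pickle_inv k) => [z|//]; case lw : (pickle_inv l) => [w|//] -> /lattice_pt_inj zw.
have := @pickle_invK 'rV[int]_d k; have := @pickle_invK 'rV[int]_d l.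
by rewrite kz lw /= => <- <-; rewrite zw.
Qed.

Lemma measurable_lattice_block k : measurable (lattice_block k).
Proof. by rewrite /lattice_block; case: pickle_inv => // z; exact: measurable_set1_rV. Qed.

Lemma measurable_int_lattice : measurable (@int_lattice R d).
Proof.
rewrite -bigcup_lattice_block; apply: bigcupT_measurable => k.
exact: measurable_lattice_block.
Qed.

End euclidean_space.

(** * Convolution operators *)

Section bounded_integral.
Context {d : measure_display} (T : measurableType d) (R : realType).
Implicit Types (mu : {finite_measure set T -> \bar R}) (u v : bmfun T R).

Lemma bmfun_integrable mu (D : set T) u : measurable D -> mu.-integrable D (EFin \o u).
Proof.
move=> mD; apply: measurable_bounded_integrable => //.
- by rewrite -ge0_fin_numE// fin_num_measure.
- exact: measurable_funTS (measurable_bmfun u).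
- have [M uM] := bounded_bmfun u; exists M; split; first by rewrite num_real.
  by move=> x Mx y _; exact: le_trans (uM y) (ltW Mx).
Qed.

Definition bint mu u : R := \int[mu]_x u x.

Lemma bintE mu u : (bint mu u)%:E = (\int[mu]_x (u x)%:E)%E.
Proof. by rewrite fineK//; apply: integrable_fin_num => //; exact: bmfun_integrable. Qed.

Lemma bint_linear mu (c : R) u v : bint mu (c *: u + v) = c * bint mu u + bint mu v.
Proof.
rewrite /bint; under eq_Rintegral do rewrite !bmfunE.
rewrite RintegralD//; [|exact: (bmfun_integrable mu (c *: u))|exact: bmfun_integrable].
by rewrite RintegralZl//; exact: bmfun_integrable.
Qed.

Lemma bintD mu u v : bint mu (u + v) = bint mu u + bint mu v.
Proof. by rewrite -[u]scale1r bint_linear scale1r mul1r. Qed.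

Lemma bintB mu u v : bint mu (u - v) = bint mu u - bint mu v.
Proof. by rewrite addrC -scaleN1r bint_linear mulN1r addrC. Qed.

Lemma bint_ge0 mu u : (forall x, 0 <= u x) -> 0 <= bint mu u.
Proof. by move=> u0; apply: Rintegral_ge0. Qed.

Lemma bint_cst mu u c : (forall x, u x = c) -> bint mu u = c * fine (mu setT).
Proof. by move=> uc; rewrite /bint; under eq_Rintegral do rewrite uc; rewrite Rintegral_cst. Qed.

Lemma bint_norm_le mu u a : bounded_by a u -> `|bint mu u| <= a * fine (mu setT).
Proof.
move=> ua; apply: (le_trans (le_normr_Rintegral _ (bmfun_integrable mu u _))) => //.
rewrite -Rintegral_cst//; apply: le_Rintegral => //.
- by apply: integrable_norm; exact: bmfun_integrable.
- exact: finite_measure_integrable_cst.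
Qed.

Fact bmcst_subproof (c : R) : cst c \in @bounded_measurable _ T R.
Proof. by apply/asboolP; split; [exact: measurable_cst|exists `|c|]. Qed.

Definition bmcst c : bmfun T R := BMFun (bmcst_subproof c).

Fact bmindic_subproof (B : set T) : measurable B -> \1_B \in @bounded_measurable _ T R.
Proof.
move=> mB; apply/asboolP; split; first exact: measurable_indic.
by exists 1 => x; rewrite indicE; case: (_ \in _); rewrite ?normr0 ?normr1.
Qed.

Definition bmindic B (mB : measurable B) : bmfun T R := BMFun (bmindic_subproof mB).

End bounded_integral.

Section convolution_operator.
Context (R : realType) (d : nat).
Local Notation V := ('rV[R]_d).
Local Notation U := (bmfun V R).
Implicit Types (mu : {finite_measure set V -> \bar R}) (u v : U) (x y z : V).

Fact shift_subproof y u : (fun z => u (y + z)) \in @bounded_measurable _ V R.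
Proof.
apply/asboolP; split.
  exact: measurableT_comp (measurable_bmfun u) (measurable_addl_rV y).
by have [M uM] := bounded_bmfun u; exists M.
Qed.

Definition shift y u : U := BMFun (shift_subproof y u).

Lemma shiftE y u z : shift y u z = u (y + z). Proof. by []. Qed.

Lemma shift_linear y : linop (shift y).
Proof. by move=> c u v; apply: bmfunP => z; rewrite bmfunE !shiftE !bmfunE. Qed.

Lemma shift_bounded y a u : bounded_by a u -> bounded_by a (shift y u).
Proof. by move=> ua z; exact: ua. Qed.

Lemma shiftD y z u : shift y (shift z u) = shift (y + z) u.
Proof. by apply: bmfunP => w; rewrite !shiftE addrA (addrC z). Qed.

Lemma shift0 u : shift 0 u = u.
Proof. by apply: bmfunP => w; rewrite shiftE add0r. Qed.

(** Measurability in y is the measurability part of Fubini, for (y, z) |-> u(y + z) on the product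
    of mu with itself. *)
Fact convop_subproof mu u :
  (fun y => bint mu (shift y u)) \in @bounded_measurable _ V R.
Proof.
apply/asboolP; split; last first.
  have [M uM] := bounded_bmfun u; exists (M * fine (mu setT)) => y.
  by apply: bint_norm_le => z; exact: uM.
pose f : V * V -> \bar R := EFin \o (u \o @mx_add R 1 d).
have f_int : (mu \x mu)%E.-integrable setT f.
  apply: measurable_bounded_integrable => //.
  - by rewrite -ge0_fin_numE//; exact: prod_fin.
  - exact: measurableT_comp (measurable_bmfun u) (@measurable_mx_add R 1 d).
  - have [M uM] := bounded_bmfun u; exists M; split; first by rewrite num_real.
    by move=> x Mx y _; exact: le_trans (uM _) (ltW Mx).
have := measurable_fubini_F f_int.
by move=> /(measurableT_comp (@fine_measurable R setT measurableT)).
Qed.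

Definition convop mu u : U := BMFun (convop_subproof mu u).

Lemma convopE mu u y : convop mu u y = bint mu (shift y u). Proof. by []. Qed.

Lemma convop_linear mu : linop (convop mu).
Proof.
by move=> c u v; apply: bmfunP => y; rewrite !bmfunE !convopE (shift_linear y) bint_linear.
Qed.

Lemma convop_shift mu y u : convop mu (shift y u) = shift y (convop mu u).
Proof.
by apply: bmfunP => z; rewrite shiftE !convopE shiftD addrC.
Qed.

Lemma convop_bounded mu a u : mu setT = 1%E -> bounded_by a u -> bounded_by a (convop mu u).
Proof.
move=> mu1 ua y; apply: (le_trans (bint_norm_le (a := a) _ _)); last by rewrite mu1 mulr1.
exact: shift_bounded.
Qed.

End convolution_operator.

(** * Convolution powers of charges *)

Section charge_powers.
Context (R : realType) (d : nat).
Local Notation V := ('rV[R]_d).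
Local Notation U := (bmfun V R).
Implicit Types (M N : {charge set V -> \bar R}) (mu nu : {finite_measure set V -> \bar R}).
Implicit Types (u v : U) (x y z : V) (B : set V).

Lemma bint_bmindic mu B (mB : measurable B) : (bint mu (bmindic R mB))%:E = mu B.
Proof. by rewrite bintE integral_indic// setIT. Qed.

(** Serves to compare differences of measures with the negative terms moved across, so that only
    measures are integrated. *)
Lemma eq_bint_add (m1 m2 m3 m4 : {finite_measure set V -> \bar R}) u :
  (forall A, measurable A -> m1 A + m2 A = m3 A + m4 A)%E ->
  bint m1 u + bint m2 u = bint m3 u + bint m4 u.
Proof.
move=> E; have mu' : measurable_fun [set: V] (EFin \o u).
  by apply/measurable_EFinP; exact: measurable_bmfun.
apply: EFin_inj; rewrite !EFinD !bintE.
rewrite -!(@integral_measure_add _ V)//; try exact: bmfun_integrable.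
apply: eq_measure_integral => A mA _.
by rewrite -[LHS]/(measure_add m1 m2 A) -[RHS]/(measure_add m3 m4 A) !measure_addE E.
Qed.

Lemma bint_scale (k : {nonneg R}) mu u : bint (mscale k mu) u = k%:num * bint mu u.
Proof.
have mu' : measurable_fun [set: V] (EFin \o u).
  by apply/measurable_EFinP; exact: measurable_bmfun.
apply: EFin_inj; rewrite EFinM !bintE; pose f : V -> \bar R := EFin \o u.
rewrite -[LHS]/(\int[mscale k mu]_x f x)%E -[X in (_ * X)%E]/(\int[mu]_x f x)%E.
rewrite (integralE (mscale k mu)) (integralE mu).
rewrite !(ge0_integral_mscale mu measurableT)//;
  [|exact: measurable_funeneg|exact: measurable_funepos].
apply/esym/muleBr => //.
exact: integrable_add_def (bmfun_integrable mu u measurableT).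
Qed.

Definition sconv M u : U := convop (pospart M) u - convop (negpart M) u.

Lemma jordanE M B : measurable B -> (pospart M B - negpart M B)%E = M B.
Proof.
move=> mB; rewrite (jordan_decomp (svalP (hahn_ex M)) mB) /cadd/= /cscale.
by rewrite EFinN mulN1e.
Qed.

(** The Hahn decomposition behind [sconv] is an arbitrary choice; this makes the operator computable
    from any convenient decomposition. *)
Lemma sconvE M mu nu u : (forall A, measurable A -> M A = mu A - nu A)%E ->
  sconv M u = convop mu u - convop nu u.
Proof.
move=> E; apply: bmfunP => y; rewrite !bmfunE !convopE.
set w := shift y u.
suff : bint (pospart M) w + bint nu w = bint mu w + bint (negpart M) w by lra.
apply: eq_bint_add => A mA.
have := E A mA; rewrite -jordanE//.
have f (m : {finite_measure set V -> \bar R}) : m A \is a fin_num by rewrite fin_num_measure.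
move: (f (pospart M)) (f (negpart M)) (f mu) (f nu).
move: (pospart M A) (negpart M A) (mu A) (nu A) => [a||] [b||] [p||] [q||]// _ _ _ _.
by rewrite -!EFinB -!EFinD => -[h]; congr EFin; lra.
Qed.

Lemma charge_prod_finiteE mu nu B (mB : measurable B) :
  charge_prod_finite mu nu (@mx_add R 1 d @^-1` B) =
  (bint mu (convop nu (bmindic R mB)))%:E.
Proof.
rewrite bintE -[LHS]/((mu \x nu)%E (@mx_add R 1 d @^-1` B)) /product_measure1.
apply: eq_integral => z _ /=.
rewrite bintE.
have mBz : measurable [set y | B (z + y)].
  by rewrite -[X in measurable X]setTI; exact: measurable_addl_rV.
transitivity (nu [set y | B (z + y)]).
  by congr (nu _); apply/seteqP; split=> y; rewrite /xsection/= in_setE.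
rewrite -(bint_bmindic nu mBz) bintE; apply: eq_integral => y _.
by rewrite shiftE /= !indicE; congr (_%:R%:E); apply/idP/idP; rewrite !in_setE.
Qed.

(** All translates are treated at once, because one more convolution integrates the previous power
    over translates of B. *)
Lemma convpowE M j B (mB : measurable B) x :
  convpow M j [set y | B (x + y)] = (iter j (sconv M) (bmindic R mB) x)%:E.
Proof.
elim: j x B mB => [|j IH] x B mB.
  rewrite /= /charge_of_finite_measure diracE indicE.
  suff -> : (0 \in [set y | B (x + y)]) = (x \in B) by [].
  by apply/idP/idP; rewrite !in_setE /= addr0.
rewrite iterS; set w := iter j _ _.
set N := convpow M j.
have mB' : measurable [set y | B (x + y)].
  by rewrite -[X in measurable X]setTI; exact: measurable_addl_rV.
pose E := @mx_add R 1 d @^-1` [set y | B (x + y)].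
rewrite -[LHS]/(charge_prod_finite (pospart M) (pospart N) E +
  charge_prod_finite (negpart M) (negpart N) E -
  (charge_prod_finite (pospart M) (negpart N) E +
   charge_prod_finite (negpart M) (pospart N) E))%E.
rewrite !(charge_prod_finiteE _ _ mB') -!EFinD; congr EFin.
(* By the induction hypothesis at the translates x + z, the j-th iterate shifted by x is the signed
   operator of N applied to the indicator. *)
pose hN := convop (pospart N) (bmindic R mB') - convop (negpart N) (bmindic R mB').
have hNE : shift x w = hN.
  apply: bmfunP => z; apply: EFin_inj; rewrite shiftE -IH -/N.
  have mz : measurable [set y | B (x + z + y)].
    by rewrite -[X in measurable X]setTI; exact: measurable_addl_rV.
  rewrite -(jordanE N mz) /hN !bmfunE !convopE EFinB.
  have muE mu : mu [set y | B (x + z + y)] = (bint mu (shift z (bmindic R mB')))%:E.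
    rewrite -(bint_bmindic mu mz); congr (bint mu _)%:E; apply: bmfunP => y.
    rewrite shiftE /= !indicE; congr (nat_of_bool _)%:R.
    by apply/idP/idP; rewrite !in_setE /= addrA.
  by rewrite !muE.
rewrite /sconv !bmfunE !convopE hNE /hN.
by rewrite !bintB; lra.
Qed.

Lemma convpow_sconv M j B (mB : measurable B) :
  convpow M j B = (iter j (sconv M) (bmindic R mB) 0)%:E.
Proof.
by rewrite -convpowE; congr (convpow M j _); apply/seteqP; split=> y; rewrite /= add0r.
Qed.

Lemma bint_dirac z u : bint (\d_ z) u = u z.
Proof.
apply: EFin_inj; rewrite bintE integral_dirac//; first by rewrite diracT mul1e.
by apply/measurable_EFinP; exact: measurable_bmfun.
Qed.

Lemma sconv_measure mu u : sconv (charge_of_finite_measure mu) u = convop mu u.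
Proof.
rewrite (sconvE (mu := mu) (nu := mzero)) => [|A mA]; last first.
  by rewrite /charge_of_finite_measure /mzero sube0.
apply: bmfunP => y; rewrite !bmfunE !convopE (_ : bint mzero _ = 0) ?subr0//.
by apply: EFin_inj; rewrite bintE integral_measure_zero.
Qed.

Lemma sconv_scale_sub_unit mu n u :
  sconv (cscale n%:R (cadd (charge_of_finite_measure mu) (copp (@unit_mass R d)))) u =
  n%:R *: (convop mu u - u).
Proof.
pose k : {nonneg R} := NngNum (ler0n R n).
rewrite (sconvE (mu := mscale k mu) (nu := mscale k (\d_ (0%R : V)))) => [|A mA]; last first.
  apply: (@muleBr _ n%:R%:E (mu A) (\d_ (0%R : V) A)) => //.
  by rewrite fin_num_adde_defl// fin_numN fin_num_measure.
by apply: bmfunP => y; rewrite !bmfunE !convopE !bint_scale bint_dirac shiftE addr0 mulrBr.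
Qed.

End charge_powers.

(** * Lattice distributions *)

Lemma esumZ_le (R : realType) (T : choiceType) (D : set T) (c : R) (a : T -> \bar R) :
  0 <= c -> (forall x, 0 <= a x)%E ->
  (\esum_(x in D) (c%:E * a x) <= c%:E * \esum_(x in D) a x)%E.
Proof.
move=> c0 a0; apply: ge_ereal_sup => _ [X [finX XD] <-].
rewrite -ge0_mule_fsumr//; apply: lee_wpmul2l; first by rewrite lee_fin.
by apply: ereal_sup_ubound; exists X.
Qed.

Section lattice_distribution.
Context (R : realType) (d : nat) (F : probability 'rV[R]_d R).
Local Notation V := ('rV[R]_d).
Local Notation U := (bmfun V R).
Hypothesis F_lattice : msupp F `<=` @int_lattice R d.
Implicit Types (u v w : U) (x y z : V) (Y : R).

Let p x : R := fine (F [set x]).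

Lemma atomE x : (p x)%:E = F [set x].
Proof. by rewrite fineK// fin_num_measure//; exact: measurable_set1_rV. Qed.

Lemma atom_ge0 x : 0 <= p x. Proof. by rewrite -lee_fin atomE. Qed.

Lemma msupp_atom x : 0 < p x -> msupp F x.
Proof.
move=> p0 U' oU' U'x; apply: (@lt_le_trans _ _ (F [set x])); first by rewrite -atomE lte_fin.
apply: le_measure; rewrite ?inE; [exact: measurable_set1_rV|exact: open_measurable_rV|].
by move=> _ ->.
Qed.

(** The complement of the lattice lies outside the support, hence is null; what remains is a
    countable union of atoms. *)
Lemma integral_lattice (f : V -> \bar R) :
  measurable_fun [set: V] f -> (forall x, 0 <= f x)%E ->
  (\int[F]_x f x = \esum_(x in @int_lattice R d) (f x * (p x)%:E))%E.
Proof.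
move=> mf f0; have mL := @measurable_int_lattice R d.
have FL0 : F (~` @int_lattice R d) = 0%E.
  apply/negligibleP; first exact: measurableC.
  by apply: negligibleS (support_compl_null F); exact: subsetC.
rewrite (ge0_negligible_integral (measurableC mL))// setTD setCK -bigcup_lattice_block.
rewrite ge0_integral_bigcup//; last first.
- exact: trivIset_lattice_block.
- exact: measurable_funTS.
- exact: measurable_lattice_block.
have a0 x : (0 <= f x * (p x)%:E)%E by rewrite mule_ge0// lee_fin atom_ge0.
rewrite esum_bigcupT//; last exact: trivIset_lattice_block.
rewrite -nneseries_esumT; last first.
  by move=> k; apply: esum_ge0.
apply: eq_eseriesr => k _; rewrite /lattice_block.
case: pickle_inv => [z|]; last by rewrite integral_set0 esum_set0.
rewrite esum_set1// (eq_integral (cst (f (lattice_pt R z)))) => [|x /[!inE] ->//].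
by rewrite integral_cst//; [rewrite atomE|exact: measurable_set1_rV].
Qed.

Lemma delta_fin Y : 0 <= Y ->
  (delta F Y)%:E = (\esum_(x in msupp F `\ (0%R : V)) (Num.min 1 (4 * Y * p x))%:E)%E.
Proof.
move=> Y0; rewrite fineK// ge0_fin_numE; last first.
  apply: esum_ge0 => x _; rewrite lee_fin le_min ler01 !mulr_ge0//; exact: atom_ge0.
apply: (@le_lt_trans _ _ (\int[F]_x (4 * Y)%:E)%E); last first.
  rewrite integral_cst//.
  by rewrite [X in (_ * X)%E](@probability_setT _ _ _ F) mule1 ltry.
rewrite integral_lattice//; last by move=> x; rewrite lee_fin mulr_ge0.
rewrite (esum_mkcond (_ `\ _)) (esum_mkcond (@int_lattice R d)); apply: le_esum => x _.
have [/[!inE] -[xF x0]|_] := boolP (x \in _ `\ _).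
  by rewrite mem_set; [rewrite -EFinM lee_fin ge_min lexx orbT|exact: F_lattice].
by case: ifP => // _; rewrite -EFinM lee_fin !mulr_ge0//; exact: atom_ge0.
Qed.

Lemma delta_ge0 Y : 0 <= Y -> 0 <= delta F Y.
Proof.
move=> Y0; rewrite -lee_fin delta_fin//; apply: esum_ge0 => x _.
by rewrite lee_fin le_min ler01 !mulr_ge0//; exact: atom_ge0.
Qed.

Lemma delta_le Y Y' : 0 <= Y -> Y <= Y' -> delta F Y <= delta F Y'.
Proof.
move=> Y0 YY; rewrite -lee_fin !delta_fin//; last exact: le_trans YY.
apply: le_esum => x _; rewrite lee_fin le_min !ge_min lexx/=; apply/orP; right.
by rewrite ler_wpM2r ?atom_ge0// ler_wpM2l.
Qed.

(** Termwise min(1, ct) <= c min(1, t) for c >= 1. Together with [delta_div_le] it says that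
    delta(Y) / Y is nonincreasing. *)
Lemma delta_scale_le c Y : 1 <= c -> 0 <= Y -> delta F (c * Y) <= c * delta F Y.
Proof.
move=> c1 Y0; have c0 : 0 <= c by exact: le_trans c1.
rewrite -lee_fin EFinM !delta_fin ?mulr_ge0//.
apply: (le_trans _ (esumZ_le _ c0 _)); last first.
  by move=> x; rewrite lee_fin le_min ler01 !mulr_ge0//; exact: atom_ge0.
apply: le_esum => x _; rewrite -EFinM lee_fin minr_pMr//.
rewrite le_min !ge_min mulr1 c1/= (_ : 4 * (c * Y) * p x = c * (4 * Y * p x)); last by ring.
by rewrite lexx orbT.
Qed.

Hypothesis F_sym : forall x, int_lattice x -> F [set x] = F [set - x].

Lemma atom_sym x : p (- x) = p x.
Proof.
have [xL|nxL] := pselect (@int_lattice R d x).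
  by rewrite /p (F_sym xL).
have nL : ~ int_lattice (- x).
  by move=> h; apply: nxL => i; have := h i; rewrite mxE rpredN.
have z y : ~ int_lattice y -> p y = 0.
  move=> yL; apply/eqP; rewrite eq_le atom_ge0 andbT leNgt.
  by apply/negP => /msupp_atom/F_lattice.
by rewrite !z.
Qed.

Lemma bint_opp u v : (forall x, v x = u (- x)) -> bint F v = bint F u.
Proof.
move=> vu; have [C uC] := bounded_bmfun u.
(* [integral_lattice] wants nonnegative integrands, so the bound [C] is added to both. *)
suff : bint F (1 *: v + bmcst V C) = bint F (1 *: u + bmcst V C).
  by rewrite !bint_linear !mul1r => /addIr.
have pos w x : (forall y, `|w y| <= C) -> 0 <= (1 *: w + bmcst V C) x.
  by move=> /(_ x); rewrite !bmfunE mul1r ler_norml => /andP[]; rewrite -lerBlDr sub0r.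
have mE w : measurable_fun [set: V] (EFin \o w) by apply/measurable_EFinP/measurable_bmfun.
apply: EFin_inj; rewrite !bintE.
rewrite (integral_lattice (mE _)) => [|x]; last first.
  by rewrite lee_fin; apply: pos => y; rewrite vu.
rewrite (integral_lattice (mE _)) => [|x]; last by rewrite lee_fin; exact: pos.
rewrite [RHS](@reindex_esum _ _ _ (@int_lattice R d) _ (fun x => - x)).
  apply: eq_esum => x _; rewrite atom_sym; congr (_ * _)%E.
  by apply: (congr1 EFin); rewrite !bmfunE vu.
split.
- by move=> x xL i; rewrite mxE rpredN.
- by move=> x y _ _ /oppr_inj.
- move=> x xL; exists (- x); last by rewrite opprK.
  by move=> i; rewrite mxE rpredN.
Qed.


Definition second_diff z u : U := shift z u + shift (- z) u - 2 *: u.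

Lemma bint_bmcst c : bint F (bmcst V c) = c.
Proof. by rewrite (@bint_cst _ _ _ _ _ c)// [X in fine X](@probability_setT _ _ _ F) /= mulr1. Qed.

(** By symmetry A u(y) is half the mean of the second differences. The term of the atom z is at most
    1/Y by hypothesis and at most 4 p_z since |u| <= 1. The smaller is min(1, 4 Y p_z) / Y, and
    these sum to delta(Y) / Y. *)
Lemma lattice_generator_le u y Y : 0 < Y -> bounded_by 1 u ->
  (forall z, z != 0 -> p z * `|second_diff z u y| <= Y^-1) ->
  `|convop F u y - u y| <= delta F Y / (2 * Y).
Proof.
move=> Y0 u1 pD.
pose w := shift y u.
have wN : (w \o -%R) \in @bounded_measurable _ V R.
  apply/asboolP; split; last by exists 1 => z; exact: u1.
  exact: measurableT_comp (measurable_bmfun w) (@measurable_opp_rV R d).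
pose w' : U := BMFun wN.
pose g : U := w + (w' - bmcst V (2 * u y)).
have gE z : g z = second_diff z u y.
  rewrite /g /second_diff !bmfunE !shiftE [z + y]addrC [- z + y]addrC -addrA.
  by congr (_ + (_ - _)).
have E : convop F u y - u y = 2^-1 * bint F g.
  rewrite /g bintD bintB (@bint_opp w w')// bint_bmcst convopE -/w.
  by field.
have gY : (\int[F]_z (Y * `|g z|)%:E <= (delta F Y)%:E)%E.
  have mg : measurable_fun [set: V] (fun z => (Y * `|g z|)%:E).
    apply/measurable_EFinP; apply: measurable_funM => //.
    by apply: measurableT_comp => //; exact: measurable_bmfun.
  rewrite integral_lattice// => [|z]; last by rewrite lee_fin mulr_ge0// ltW.
  rewrite delta_fin ?(ltW Y0)// (esum_mkcond (@int_lattice R d)) (esum_mkcond (_ `\ _)).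
  apply: le_esum => z _; rewrite -EFinM.
  have b0 : 0 <= Num.min 1 (4 * Y * p z).
    by rewrite le_min ler01 !mulr_ge0 ?atom_ge0// ltW.
  have [zS|zS] := boolP (z \in _ `\ _); last first.
    case: ifP => // _; rewrite lee_fin.
    have [->|z0] := eqVneq z 0.
      rewrite gE /second_diff !bmfunE !shiftE oppr0 !add0r.
      by rewrite (_ : u y + u y - 2 * u y = 0) ?normr0 ?mulr0 ?mul0r//; ring.
    suff -> : p z = 0 by rewrite mulr0.
    apply/eqP; rewrite eq_le atom_ge0 andbT leNgt; apply/negP => /msupp_atom zF.
    by move/negP: zS; apply; rewrite inE; split=> //; exact/eqP.
  move: zS => /[!inE] -[zF /eqP z0]; rewrite mem_set; last exact: F_lattice.
  rewrite lee_fin le_min; apply/andP; split.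
    by have := pD z z0; rewrite gE -[Y^-1]mul1r ler_pdivlMr//; lra.
  apply: ler_wpM2r; first exact: atom_ge0.
  rewrite mulrC ler_wpM2r// ?(ltW Y0)// gE /second_diff !bmfunE !shiftE.
  have := u1 (z + y); have := u1 (- z + y); have := u1 y.
  rewrite !ler_norml => /andP[? ?] /andP[? ?] /andP[? ?]; apply/andP; split; lra.
rewrite E normrM ger0_norm ?invr_ge0// invfM mulrCA ler_pM2l ?invr_gt0//.
rewrite ler_pdivlMr// mulrC -lee_fin; apply: le_trans gY.
under eq_integral do rewrite EFinM.
rewrite ge0_integralZl//; last 2 first.
- by apply/measurable_EFinP/measurableT_comp => //; exact: measurable_bmfun.
- by rewrite lee_fin ltW.
rewrite EFinM; apply: lee_wpmul2l; first by rewrite lee_fin ltW.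
have intg := bmfun_integrable F g measurableT.
rewrite /bint EFin_normr_Rintegral//; apply: le_abse_integral => //.
by apply/measurable_EFinP; exact: measurable_bmfun.
Qed.

Let q : R := p 0.

Lemma bmindic_atom z : bint F (bmindic R (measurable_set1_rV z)) = p z.
Proof. by apply: EFin_inj; rewrite bint_bmindic atomE. Qed.

(** The points 0, z, -z are distinct as z is nonzero. The slack [c <= p z] allows only part of the
    two outer atoms to be used. *)
Lemma three_atoms_le (f : U) z c : z != 0 -> (forall x, 0 <= f x) -> 0 <= c <= p z ->
  q * f 0 + c * (f z + f (- z)) <= bint F f.
Proof.
move=> z0 f0 /andP[c0 cp].
pose I x := bmindic R (measurable_set1_rV x).
have Nz : - z != z.
  by rewrite -subr_eq0 -opprD oppr_eq0 -mulr2n -(scaler_nat (R := R)) scaler_eq0 negb_or pnatr_eq0 z0.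
pose h : U := f 0 *: I 0 + (f z *: I z + (f (- z) *: I (- z) + 0)).
have hf x : h x <= f x.
  have IE a : I a x = (x == a)%:R.
    rewrite -[LHS]/(\1_[set a] x) indicE; congr (nat_of_bool _)%:R.
    by apply/idP/eqP; rewrite in_setE.
  rewrite /h !bmfunE !IE addr0.
  have [->|x0] := eqVneq x 0.
    by rewrite [0 == z]eq_sym (negPf z0) [0 == - z]eq_sym oppr_eq0 (negPf z0) ?eqxx /=; lra.
  have [->|xz] := eqVneq x z.
    by rewrite [z == - z]eq_sym (negPf Nz) ?eqxx ?(negPf z0) /=; lra.
  have [->|xNz] := eqVneq x (- z); last by have := f0 x; rewrite /=; lra.
  by rewrite ?oppr_eq0 ?(negPf z0) ?(negPf Nz) ?eqxx /=; lra.
have bh : bint F h = f 0 * q + (f z * p z + f (- z) * p z).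
  rewrite /h !bint_linear (@bint_cst _ _ _ _ (0 : U) 0)// mul0r addr0 !bmindic_atom.
  by rewrite atom_sym.
apply: (@le_trans _ _ (bint F h)).
  by rewrite bh; have := f0 z; have := f0 (- z); nra.
rewrite -subr_ge0 -bintB; apply: bint_ge0 => x.
by rewrite !bmfunE subr_ge0; exact: hf.
Qed.

Lemma atoms_sum_le1 z : z != 0 -> q + 2 * p z <= 1.
Proof.
move=> z0; have := @three_atoms_le (bmcst V 1) z (p z) z0 (fun=> ler01).
rewrite bint_bmcst /=.
by rewrite atom_ge0 lexx => /(_ isT); lra.
Qed.

Lemma convop_remainder_le z c b w : z != 0 -> 0 <= c <= p z -> bounded_by b w ->
  bounded_by ((1 - q - 2 * c) * b)
    (convop F w - q *: w - c *: (shift z w + shift (- z) w)).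
Proof.
move=> z0 cp wb y.
(* What is left of F after removing the three masses is a positive measure; it is tested on the
   nonnegative functions b + w and b - w. *)
have H (s : R) : `|s| = 1 ->
    q * (b + s * w y) + c * (b + s * w (z + y) + (b + s * w (- z + y))) <= b + s * convop F w y.
  move=> s1; have := @three_atoms_le (s *: shift y w + bmcst V b) z c z0.
  rewrite bint_linear bint_bmcst.
  rewrite convopE !bmfunE !shiftE addr0 [y + z]addrC [y - z]addrC.
  rewrite [b + s * bint _ _]addrC ![b + s * _]addrC; apply => // x.
  rewrite !bmfunE -lerBlDr sub0r shiftE.
  have : `|s * w (y + x)| <= b by rewrite normrM s1 mul1r; exact: wb.
  by rewrite ler_norml => /andP[].
have := H 1 (normr1 _); have := H (-1) (normrN1 _).
rewrite !bmfunE !shiftE; set W := convop F w y => h1 h2.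
by rewrite ler_norml; apply/andP; split; nra.
Qed.

Lemma iter_second_diff (T : U -> U) j z u : linop T ->
  (forall x w, T (shift x w) = shift x (T w)) ->
  iter j T (second_diff z u) = second_diff z (iter j T u).
Proof.
move=> lT Ts; have lj := iter_linear j lT.
by rewrite /second_diff !(linopD lj) (linopN lj) (linopZ lj) !(iter_comm _ _ (Ts _)).
Qed.

Lemma shiftK z w : shift z (shift (- z) w) = w.
Proof. by rewrite shiftD addrN shift0. Qed.

Lemma shiftNK z w : shift (- z) (shift z w) = w.
Proof. by rewrite shiftD addNr shift0. Qed.

Lemma iter_convop_second_diff j z u y : 0 < q -> z != 0 -> bounded_by 1 u ->
  p z * `|second_diff z (iter j (convop F) u) y| <= (j.+1%:R * q)^-1.
Proof.
move=> q0 z0 u1; have q2p := atoms_sum_le1 z0.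
have jq0 : 0 < j.+1%:R * q by rewrite mulr_gt0// ltr0n.
have := atom_ge0 z; rewrite le_eqVlt => /predU1P[<-|pz0].
  by rewrite mul0r invr_ge0 ltW.
(* [second_diff_le] needs c <= q / 2, so a larger atom is used only in part. Then p_z / c is 1 or 2
   p_z / q, and at most 1/q either way because 2 p_z <= 1. *)
pose c := Num.min (p z) (q / 2).
have c0 : 0 < c by rewrite lt_min pz0 divr_gt0.
have cp : c <= p z by rewrite ge_min lexx.
have lT := convop_linear F.
have Ts x w : convop F (shift x w) = shift x (convop F w) by rewrite convop_shift.
have /(_ y) : bounded_by (1 / (j.+1%:R * c)) (iter j (convop F) (second_diff z u)).
  apply: (@second_diff_le _ _ _ _ _ _ c q) => //.
  - exact: shift_linear.
  - exact: shift_linear.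
  - by rewrite ge_min lexx orbT.
  - by lra.
  - exact: shiftK.
  - exact: shiftNK.
  - by move=> b w; exact: shift_bounded.
  - by move=> b w; exact: shift_bounded.
  - by move=> b w; apply: convop_remainder_le => //; rewrite ltW.
rewrite iter_second_diff// => h; apply: (le_trans (ler_wpM2l (ltW pz0) h)).
have jc0 : 0 < j.+1%:R * c by rewrite mulr_gt0// ltr0n.
rewrite mulrA mulr1 ler_pdivrMr// mulrC ler_pdivlMr// mulrCA ler_pM2l ?ltr0n//.
rewrite le_min; apply/andP; split; first by nra.
by rewrite ler_pdivlMr//; nra.
Qed.

(** One lazy step has mass 1 - 1/K + q/K at 0 and p_z / K at z. For K >= 2 the latter is at most
    half of the former, so the whole atom can be used and no power of q is lost. *)
Lemma act_lazy_second_diff K J z u y : 0 <= q -> (1 < K)%N -> z != 0 -> bounded_by 1 u ->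
  p z * `|second_diff z (act (convop F) (lazy_poly R K ^+ J) u) y| <= (J.+1%:R / K%:R)^-1.
Proof.
move=> q0 K1 z0 u1; have q2p := atoms_sum_le1 z0.
have K0 : 0 < K%:R^-1 :> R by rewrite invr_gt0 ltr0n ltnW.
have K2 : K%:R^-1 <= 1 / 2 :> R.
  by rewrite div1r lef_pV2 ?posrE ?ltr0n ?(ltnW K1)// ler_nat.
have := atom_ge0 z; rewrite le_eqVlt => /predU1P[<-|pz0].
  by rewrite mul0r invr_ge0 mulr_ge0// ltW.
have lT := convop_linear F.
pose G := act (convop F) (lazy_poly R K).
have lG : linop G by exact: act_linear.
have GE w : G w = w + K%:R^-1 *: (convop F w - w).
  by rewrite /G /lazy_poly actD act1 actZ actD actX actN act1.
have Gs x w : G (shift x w) = shift x (G w).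
  by apply: bmfunP => v; rewrite !GE convop_shift shiftE !bmfunE !shiftE.
rewrite actXp//.
have /(_ y) : bounded_by (1 / (J.+1%:R * (K%:R^-1 * p z))) (iter J G (second_diff z u)).
  apply: (@second_diff_le _ _ _ _ _ _ (K%:R^-1 * p z) (1 - K%:R^-1 + K%:R^-1 * q)) => //.
  - exact: shift_linear.
  - exact: shift_linear.
  - exact: mulr_gt0.
  - by nra.
  - by nra.
  - exact: shiftK.
  - exact: shiftNK.
  - by move=> b w; exact: shift_bounded.
  - by move=> b w; exact: shift_bounded.
  - move=> b w wb; rewrite GE.
    have := bounded_byZ K%:R^-1 (@convop_remainder_le z (p z) b w z0 _ wb).
    rewrite atom_ge0 lexx (gtr0_norm K0) => /(_ isT).
    congr (bounded_by _ _); first by ring.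
    by apply: bmfunP => v; rewrite !bmfunE; ring.
rewrite iter_second_diff// => h; apply: (le_trans (ler_wpM2l (ltW pz0) h)).
rewrite le_eqVlt; apply/orP; left; apply/eqP; field.
by rewrite !gt_eqF ?ltr0n ?(ltnW K1).
Qed.

End lattice_distribution.

(** * Operator bounds *)

Lemma opnorm_le_unit d (V : measurableType d) (R : realType) (T : bmfun V R -> bmfun V R)
    c (P : {poly R}) : linop T ->
  (forall u, bounded_by 1 u -> bounded_by c (act T P u)) -> opnorm_le T c P.
Proof.
move=> lT H a u a0 ua; have lP := act_linear lT P.
move: a0; rewrite le_eqVlt => /predU1P[a0|a0].
  have -> : u = 0 by apply: bmfunP => x; apply/eqP; rewrite -normr_le0 a0.
  by rewrite (linop0 lP) -a0 mulr0 => x; rewrite bmfunE normr0.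
have -> : u = a *: (a^-1 *: u) by rewrite scalerA divff ?scale1r// gt_eqF.
rewrite (linopZ lP) mulrC -{1}(gtr0_norm a0); apply/bounded_byZ/H.
have := bounded_byZ a^-1 ua.
by rewrite gtr0_norm ?invr_gt0// mulVf ?gt_eqF.
Qed.

Lemma expr4_le_sqrM (R : realDomainType) (e a b : R) : 0 <= e -> e <= a -> e <= b ->
  e ^+ 4 <= a ^+ 2 * b ^+ 2.
Proof.
move=> e0 ea eb; have a0 := le_trans e0 ea; have b0 := le_trans e0 eb.
by rewrite (exprD e 2 2) ler_pM ?exprn_ge0// lerXn2r.
Qed.

Section operator_bounds.
Context (R : realType) (d : nat) (F : probability 'rV[R]_d R).
Local Notation V := ('rV[R]_d).
Local Notation A := ('X - 1 : {poly R}).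
Local Notation T := (convop F).
Local Notation q := (fine (F [set (0 : V)])).
Hypothesis F_lattice : msupp F `<=` @int_lattice R d.
Hypothesis F_sym : forall x, int_lattice x -> F [set x] = F [set - x].
Hypothesis q01 : 0 < q < 1.

Let q0 : 0 < q. Proof. by case/andP: q01. Qed.
Let q1 : q <= 1. Proof. by case/andP: q01 => _ /ltW. Qed.
Let lT : linop T. Proof. exact: convop_linear. Qed.
Let bT a u : bounded_by a u -> bounded_by a (T u).
Proof. by apply: convop_bounded; exact: probability_setT. Qed.

Lemma actA_le u y Y : 0 < Y -> bounded_by 1 u ->
  (forall z, z != 0 -> fine (F [set z]) * `|second_diff z u y| <= Y^-1) ->
  `|act T A u y| <= delta F Y / (2 * Y).
Proof.
move=> Y0 u1 H; rewrite actD actX actN act1 !bmfunE.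
exact: lattice_generator_le.
Qed.

Lemma delta_div_le Y0 Y : 0 < Y0 -> Y0 <= Y ->
  delta F Y / (2 * Y) <= delta F Y0 / (2 * Y0).
Proof.
move=> Y00 YY; have Yp : 0 < Y by exact: lt_le_trans YY.
rewrite ler_pdivrMr ?mulr_gt0// (_ : delta F Y0 / (2 * Y0) * (2 * Y) = Y / Y0 * delta F Y0).
  2: by field; rewrite gt_eqF.
rewrite -{1}(divfK (lt0r_neq0 Y00) Y); apply: delta_scale_le => //; last exact: ltW.
by rewrite ler_pdivlMr// mul1r.
Qed.

(** The bound without smoothing, at Y = 1/2: |D_z u| <= 4 and p_z <= 1/2 give p_z |D_z u| <= 2 =
    1/Y. *)
Lemma opnorm_A : opnorm_le T (delta F (1 / 2)) A.
Proof.
apply: opnorm_le_unit => // u u1 y.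
rewrite (_ : delta F (1 / 2) = delta F (1 / 2) / (2 * (1 / 2))); last first.
  by rewrite [2 * _]mulrC divfK ?divr1// pnatr_eq0.
apply: actA_le => // z z0.
have := atoms_sum_le1 F_lattice F_sym z0.
have := atom_ge0 F z; have := u1 y; have := u1 (z + y); have := u1 (- z + y).
rewrite /second_diff !bmfunE !shiftE => h1 h2 h3.
have : `|u (z + y) + u (- z + y) - 2 * u y| <= 4.
  by move: h1 h2 h3; rewrite !ler_norml => /andP[? ?] /andP[? ?] /andP[? ?]; apply/andP; split; lra.
rewrite (_ : (1 / 2)^-1 = 2); last by field.
have := q0; set D := `|_|; have : 0 <= D := normr_ge0 _.
by set pz := fine (F [set z]); nra.
Qed.

Lemma opnorm_A_X i Y : 0 < Y -> Y <= i.+1%:R * q ->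
  opnorm_le T (delta F Y / (2 * Y)) (A * 'X ^+ i).
Proof.
move=> Y0 Yi; apply: opnormW (delta_div_le Y0 Yi) _.
apply: opnorm_le_unit => // u u1 y; rewrite actM// actXn.
apply: actA_le => [||z z0]; first exact: lt_le_trans Yi.
  by apply: iter_bounded => // w; exact: bT.
by apply: iter_convop_second_diff.
Qed.

Lemma opnorm_A_lazy K J Y : (1 < K)%N -> 0 < Y -> Y <= J.+1%:R / K%:R ->
  opnorm_le T (delta F Y / (2 * Y)) (A * lazy_poly R K ^+ J).
Proof.
move=> K1 Y0 YJ; apply: opnormW (delta_div_le Y0 YJ) _.
apply: opnorm_le_unit => // u u1 y; rewrite actM//.
apply: actA_le => [||z z0]; first exact: lt_le_trans YJ.
  rewrite -[1]mul1r; apply: opnorm_exp1 => //.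
  by apply: opnorm_lazy_poly => //; exact: ltnW.
by apply: act_lazy_second_diff => //; exact: ltW.
Qed.

Lemma delta_half_le (n : nat) : delta F (n%:R / 2) <= delta F (n%:R * q) / q.
Proof.
have nq0 : 0 <= n%:R * q by rewrite mulr_ge0// ltW.
have [q2|q2] := leP (1 / 2) q.
  apply: (@le_trans _ _ (delta F (n%:R * q))).
    by apply: delta_le => //; rewrite -[_^-1]div1r ler_wpM2l.
  by rewrite ler_pdivlMr// ler_piMr// delta_ge0.
rewrite (_ : n%:R / 2 = (2 * q)^-1 * (n%:R * q)); last by field; rewrite gt_eqF.
apply: (le_trans (delta_scale_le _ _ _)) => //.
  by rewrite -[leLHS]invr1 lef_pV2 ?posrE ?mulr_gt0//; lra.
rewrite mulrC ler_wpM2l ?delta_ge0// lef_pV2 ?posrE ?mulr_gt0//. by have := q0; lra.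
Qed.

Lemma opnorm_lazy_diff_le2 K n m : (0 < K)%N ->
  opnorm_le T 2 ('X ^+ n - lazy_poly R K ^+ m).
Proof.
move=> K0; rewrite -[2]/(1 + 1); apply: opnormD.
  by apply: opnorm_exp1 => //; exact: opnormX.
by apply/opnormN/opnorm_exp1 => //; exact: opnorm_lazy_poly.
Qed.

(** There are m - 1 steps in all, j of T and the others of S, so one kind has at least about half of
    them. That kind is cut into four quarters, one for each factor A. The constant 4096 = 8^4 comes
    from the case of S; the case of T gives 4^4. *)
Lemma opnorm_fourth (k m j : nat) : (0 < k)%N -> (j < m)%N ->
  opnorm_le T (4096 * delta F (m.+1%:R / 2) ^+ 2 * delta F (m.+1%:R * q) ^+ 2 /
                 (q ^+ 4 * m.+1%:R ^+ 4))
    (A ^+ 4 * ('X ^+ j * lazy_poly R (4 * k) ^+ (4 * k * (m.-1 - j)))).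
Proof.
move=> k0 jm; have qp := q0; have qle := q1; set N : R := m.+1%:R.
set D := delta F (N / 2); set E := delta F (N * q).
have N0 : 0 < N by rewrite ltr0n.
have K0 : (0 < 4 * k)%N by rewrite muln_gt0.
have D0 : 0 <= D by rewrite delta_ge0// divr_ge0// ltW.
have E0 : 0 <= E by rewrite delta_ge0// mulr_ge0// ltW.
have DE : D <= E / q := delta_half_le m.+1.
have [jbig|jsmall] := leqP m.-1 (2 * j).
  pose i := (j %/ 4)%N; pose Y := N * q / 8.
  have Y0 : 0 < Y by rewrite divr_gt0// mulr_gt0.
  have Yi : Y <= i.+1%:R * q.
    have : N <= i.+1%:R * 8 
      by rewrite /N -natrM ler_nat /i; move: jm jbig; clear; lia.
    by rewrite /Y; nra.
  have h := opnorm_A_X Y0 Yi.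
  set e := delta F Y / (2 * Y) in h.
  have e0 : 0 <= e by rewrite divr_ge0 ?delta_ge0 ?mulr_ge0// ltW.
  have eE : e <= 4 * E / (N * q).
    rewrite /e (_ : 4 * E / (N * q) = E / (2 * Y)); last by rewrite /Y; field; rewrite !gt_eqF.
    rewrite ler_pM2r ?invr_gt0 ?mulr_gt0//; apply: delta_le => //; first exact: ltW.
    by rewrite /Y; have := mulr_gt0 N0 qp; lra.
  have eD : e <= 4 * D / (N * q).
    rewrite /e (_ : 4 * D / (N * q) = D / (2 * Y)); last by rewrite /Y; field; rewrite !gt_eqF.
    rewrite ler_pM2r ?invr_gt0 ?mulr_gt0//; apply: delta_le => //; first exact: ltW.
    by rewrite /Y; nra.
  rewrite {1}(divn_eq j 4) -/i.
  rewrite (_ : A ^+ 4 * _ = (A * 'X ^+ i) ^+ 4 *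
    ('X ^+ (j %% 4) * lazy_poly R (4 * k) ^+ (4 * k * (m.-1 - j)))); last first.
    by rewrite exprD exprM; ring.
  apply: (@opnormW _ _ _ _ (e ^+ 4 * (1 * 1))); last first.
    apply: opnormM => //; first exact: opnorm_exp.
    apply: opnormM => //; first by apply: opnorm_exp1 => //; exact: opnormX.
    by apply: opnorm_exp1 => //; exact: opnorm_lazy_poly.
  rewrite !mulr1; apply: (le_trans (expr4_le_sqrM e0 eE eD)).
  rewrite [leLHS](_ : _ = 256 * (D ^+ 2 * E ^+ 2 / (q ^+ 4 * N ^+ 4))); last first.
    by field; rewrite !gt_eqF.
  have : 0 <= D ^+ 2 * E ^+ 2 / (q ^+ 4 * N ^+ 4).
    by rewrite divr_ge0// mulr_ge0// ?exprn_ge0// ltW.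
  rewrite [X in _ -> _ <= X](_ : _ = 4096 * (D ^+ 2 * E ^+ 2 / (q ^+ 4 * N ^+ 4))).
    by set X := D ^+ 2 * E ^+ 2 / (q ^+ 4 * N ^+ 4) => X0; lra.
  by rewrite !mulrA.
(* Each of the four factors A receives [k * r] of the 4 k r lazy steps, which is why K has the form
   4k. *)
pose r := (m.-1 - j)%N; pose Y := N / 16.
have Y0 : 0 < Y by rewrite divr_gt0.
have K1 : (1 < 4 * k)%N by rewrite (leq_trans _ (leq_pmulr 4 k0)).
have Yr : Y <= (k * r).+1%:R / (4 * k)%:R.
  rewrite ler_pdivlMr ?ltr0n// /Y mulrAC ler_pdivrMr// /N -!natrM ler_nat.
  have : (m.+1 <= 4 * r)%N by rewrite /r; move: jm jsmall; clear; lia.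
  by move: k0; clear; nia.
have h := opnorm_A_lazy K1 Y0 Yr.
set e := delta F Y / (2 * Y) in h.
have e0 : 0 <= e by rewrite divr_ge0 ?delta_ge0 ?mulr_ge0// ltW.
have eD : e <= 8 * D / N.
  rewrite /e (_ : 8 * D / N = D / (2 * Y)); last by rewrite /Y; field; rewrite !gt_eqF.
  rewrite ler_pM2r ?invr_gt0 ?mulr_gt0//; apply: delta_le => //; first exact: ltW.
  by rewrite /Y; lra.
(* [DE] gives 1/q; it is weakened to 1/q^2 so that two such factors yield the q^-4 of the other
   case. *)
have eE : e <= 8 * E / (N * q ^+ 2).
  apply: (le_trans eD); rewrite (_ : 8 * E / _ = 8 * (E / q ^+ 2) / N); last first.
    by field; rewrite !gt_eqF.
  rewrite ler_pM2r ?invr_gt0// ler_pM2l//; apply: (le_trans DE).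
  by apply: ler_wpM2l => //; rewrite lef_pV2 ?posrE ?exprn_gt0//; nra.
rewrite (_ : A ^+ 4 * _ = (A * lazy_poly R (4 * k) ^+ (k * r)) ^+ 4 * 'X ^+ j); last first.
  rewrite -/r (_ : (4 * k * r)%N = (k * r * 4)%N); last by rewrite -mulnA mulnC.
  by rewrite exprM; ring.
apply: (@opnormW _ _ _ _ (e ^+ 4 * 1)); last first.
  apply: opnormM => //; first exact: opnorm_exp.
  by apply: opnorm_exp1 => //; exact: opnormX.
rewrite mulr1; apply: (le_trans (expr4_le_sqrM e0 eD eE)).
by rewrite le_eqVlt; apply/orP; left; apply/eqP; field; rewrite !gt_eqF.
Qed.

End operator_bounds.

(** * Total variation distance *)

Section exponential_bound.
Context (R : realType) (d : nat) (F : probability 'rV[R]_d R).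
Local Notation V := ('rV[R]_d).
Local Notation A := ('X - 1 : {poly R}).
Local Notation T := (convop F).

Let lT : linop T. Proof. exact: convop_linear. Qed.
Let bT a u : bounded_by a u -> bounded_by a (T u).
Proof. by apply: convop_bounded; exact: probability_setT. Qed.

Lemma convop_bmcst c : T (bmcst V c) = bmcst V c.
Proof. by apply: bmfunP => y; rewrite convopE -[RHS](bint_bmcst F); congr bint; exact: bmfunP. Qed.

(* Replacing the indicator by a function with values in {-1, 1} gains the factor 1/2
   between the norm and the distance in total variation. *)
Lemma act_diff_indic_le c K n m B (mB : measurable B) y :
  opnorm_le T c ('X ^+ n - lazy_poly R K ^+ m) ->
  `|act T ('X ^+ n - lazy_poly R K ^+ m) (bmindic R mB) y| <= c / 2.
Proof.
move=> hc; set P := _ - _ in hc *; have lP := act_linear lT P.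
pose g : bmfun V R := 2 *: bmindic R mB - bmcst V 1.
have g1 : bounded_by 1 g.
  move=> x; rewrite !bmfunE -[bmindic R mB x]/(\1_B x) -[bmcst V 1 x]/1 indicE.
  by rewrite ler_norml; case: (_ \in _) => /=; apply/andP; split; lra.
have iter_cst (f : bmfun V R -> bmfun V R) j : f (bmcst V 1) = bmcst V 1 ->
    iter j f (bmcst V 1) = bmcst V 1 by move=> fc; elim: j => //= j ->.
(* Both T and the lazy step fix constants, so the difference of their powers kills them. *)
have P1 : act T P (bmcst V 1) = 0.
  rewrite /P actD actN actXn actXp// !iter_cst ?subrr ?convop_bmcst//.
  rewrite /lazy_poly actD act1 actZ actD actX actN act1 convop_bmcst subrr.
  by rewrite scaler0 addr0.
have -> : bmindic R mB = 2^-1 *: (g + bmcst V 1).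
  by rewrite subrK scalerA mulVf ?scale1r ?pnatr_eq0.
rewrite (linopZ lP) (linopD lP) P1 addr0 bmfunE normrM ger0_norm ?invr_ge0//.
by rewrite mulrC ler_wpM2r ?invr_ge0// -[c]mulr1; exact: hc.
Qed.

Lemma sconv_exp_iter n j B (mB : measurable B) :
  convpow (cscale n%:R (cadd (charge_of_finite_measure F) (copp (@unit_mass R d)))) j B =
  (n%:R ^+ j * act T (A ^+ j) (bmindic R mB) 0)%:E.
Proof.
rewrite (convpow_sconv _ _ mB); congr EFin.
suff -> : iter j (sconv (cscale n%:R (cadd (charge_of_finite_measure F)
    (copp (@unit_mass R d))))) (bmindic R mB) = n%:R ^+ j *: act T (A ^+ j) (bmindic R mB).
  by [].
elim: j => [|j IH]; first by rewrite /= act1 scale1r.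
rewrite iterS IH sconv_scale_sub_unit exprS -scalerA -[A ^+ j.+1]/(A ^+ j.+1) exprS actM//.
by rewrite actD actX actN act1 (linopZ lT) -scalerBr.
Qed.

Lemma opnorm_A2 : opnorm_le T 2 A.
Proof.
by rewrite -[2]/(1 + 1); apply: opnormD; [exact: opnormX|exact/opnormN/opnorm1].
Qed.

(** As |A| <= 2, the series is dominated by that of exp(2n). *)
Lemma conv_exp_cvg n B (mB : measurable B) : exists2 l,
  series (fun j => n%:R ^+ j / j`!%:R * act T (A ^+ j) (bmindic R mB) 0) @ \oo --> l &
  conv_exp (cscale n%:R (cadd (charge_of_finite_measure F) (copp (@unit_mass R d)))) B = l%:E.
Proof.
set b := fun j => act T (A ^+ j) (bmindic R mB) 0.
have b2 j : `|b j| <= 2 ^+ j.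
  rewrite -[2 ^+ j]mulr1; apply: opnorm_exp => //; first exact: opnorm_A2.
  move=> x; rewrite -[bmindic R mB x]/(\1_B x) indicE.
  by case: (_ \in _); rewrite ?normr0 ?normr1.
set s := series _.
have cs : cvgn s.
  apply: normed_cvg; apply: (series_le_cvg _ _ _ (@is_cvg_series_exp_coeff R (2 * n%:R))) => j.
  - exact: normr_ge0.
  - by rewrite /exp_coeff/= divr_ge0// exprn_ge0// mulr_ge0.
  - rewrite /exp_coeff/= normrM ger0_norm ?divr_ge0 ?exprn_ge0//.
    rewrite [leRHS](_ : _ = n%:R ^+ j / j`!%:R * 2 ^+ j); last by rewrite exprMn; ring.
    by apply: ler_wpM2l; rewrite ?divr_ge0 ?exprn_ge0//; exact: b2.
exists (limn s); first exact: cs.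
rewrite /conv_exp.
have E : (fun N => \sum_(0 <= j < N) (((j`!%:R^-1)%R%:E *
   convpow (cscale n%:R (cadd (charge_of_finite_measure F) (copp (@unit_mass R d)))) j B)%E)) =
   EFin \o s.
  apply/funext => N /=; rewrite /s /series/= -sumEFin; apply: eq_bigr => j _.
  by rewrite (sconv_exp_iter n j mB) -EFinM mulrA [_^-1 * _]mulrC.
by rewrite E EFin_lim.
Qed.

Lemma dTV_convpow_exp_le (n : nat) c : (0 < n)%N ->
  (forall k, (0 < k)%N -> opnorm_le T c ('X ^+ n - lazy_poly R (4 * k) ^+ (4 * k * n))) ->
  (dTV (convpow (charge_of_finite_measure F) n)
    (conv_exp (cscale n%:R (cadd (charge_of_finite_measure F) (copp (@unit_mass R d)))))
   <= (c / 2)%:E)%E.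
Proof.
move=> n0 hc; apply: ge_ereal_sup => _ [B mB <-].
have [l cl ->] := conv_exp_cvg n mB.
rewrite (convpow_sconv _ _ mB) -EFinB abse_EFin lee_fin.
rewrite (eq_iter (sconv_measure F)) -actXn.
apply: (exp_limit_bound n0 _ cl) => [j|K K0 /dvdnP[k kE]].
  rewrite -[2 ^+ j]mulr1; apply: opnorm_exp => //; first exact: opnorm_A2.
  move=> x; rewrite -[bmindic R mB x]/(\1_B x) indicE.
  by case: (_ \in _); rewrite ?normr0 ?normr1.
have k0 : (0 < k)%N by move: K0; rewrite kE; lia.
rewrite mulnC in kE; rewrite {K}kE in K0 *.
have := @act_diff_indic_le c (4 * k) n (n * (4 * k)) B mB 0.
rewrite [(n * _)%N]mulnC => /(_ (hc k k0)).
rewrite actD actN bmfunD bmfunN.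
suff -> : act T (lazy_poly R (4 * k) ^+ (4 * k * n)) (bmindic R mB) 0 =
   \sum_(j < (4 * k * n).+1)
     'C(4 * k * n, j)%:R / (4 * k)%:R ^+ j * act T (A ^+ j) (bmindic R mB) 0.
  by [].
(* The binomial expansion of (1 + A/K)^(Kn) in powers of A brings the sum into the form of
   [exp_limit_bound]. *)
rewrite /lazy_poly exprDn.
rewrite (big_morph (fun P => act T P (bmindic R mB) 0) (id1 := 0) (op1 := +%R));
  [|by move=> P Q; rewrite actD|by rewrite actC scale0r].
apply: eq_bigr => j _.
rewrite expr1n mul1r exprZn -[_ *+ 'C(_, _)]scaler_nat !actZ !bmfunZ exprVn.
by rewrite mulrA.
Qed.

End exponential_bound.

(** * Main term and the final estimate *)

Section main_bound.
Context (R : realType) (d : nat) (F : probability 'rV[R]_d R).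
Local Notation V := ('rV[R]_d).
Local Notation A := ('X - 1 : {poly R}).
Local Notation T := (convop F).
Local Notation q := (fine (F [set (0 : V)])).
Hypothesis F_lattice : msupp F `<=` @int_lattice R d.
Hypothesis F_sym : forall x, int_lattice x -> F [set x] = F [set - x].
Hypothesis q01 : 0 < q < 1.

Let lT : linop T. Proof. exact: convop_linear. Qed.
Let bT a u : bounded_by a u -> bounded_by a (T u).
Proof. by apply: convop_bounded; exact: probability_setT. Qed.

(** Half of the lazy steps go to each of the two factors A, which gives (D/m)^2; the factor 1 + 6/(m
    + 1) pays for replacing m by m + 1. For m = 0 nothing is smoothed. *)
Lemma opnorm_main (k m : nat) : (0 < k)%N -> 
  opnorm_le T (((1 + 6 / m.+1%:R) * (delta F (m.+1%:R / 2) / m.+1%:R) ^+ 2))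
    (A ^+ 2 * lazy_poly R (4 * k) ^+ (4 * k * m)).
Proof.
move=> k0; set N : R := m.+1%:R; set D := delta F (N / 2).
have K0 : (0 < 4 * k)%N by rewrite muln_gt0.
have K1 : (1 < 4 * k)%N by rewrite (leq_trans _ (leq_pmulr 4 k0)).
have N0 : 0 < N by rewrite ltr0n.
have D0 : 0 <= D by rewrite delta_ge0// divr_ge0// ltW.
case: (posnP m) => [m0|mpos].
  have N1 : N = 1 by rewrite /N m0.
  rewrite m0 muln0 expr0 mulr1.
  apply: (@opnormW _ _ _ _ (D ^+ 2)).
    by rewrite N1 !divr1; have := sqr_ge0 D; lra.
  by apply: opnorm_exp => //; rewrite /D N1; exact: opnorm_A.
have M0 : 0 < m%:R :> R by rewrite ltr0n.
pose Y : R := m%:R / 2.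
have Y0 : 0 < Y by rewrite divr_gt0.
have YJ : Y <= (2 * k * m).+1%:R / (4 * k)%:R.
  rewrite ler_pdivlMr ?ltr0n// /Y mulrAC ler_pdivrMr// -!natrM ler_nat; nia.
have h := @opnorm_A_lazy _ _ _ F_lattice F_sym q01 _ _ _ K1 Y0 YJ.
have e0 : 0 <= delta F Y / (2 * Y) by rewrite divr_ge0 ?delta_ge0 ?mulr_ge0// ltW.
have YE : 2 * Y = m%:R by rewrite /Y mulrC divfK.
apply: (@opnormW _ _ _ _ ((delta F Y / (2 * Y)) ^+ 2)); last first.
  rewrite (_ : A ^+ 2 * _ = (A * lazy_poly R (4 * k) ^+ (2 * k * m)) ^+ 2).
    exact: opnorm_exp.
  by rewrite exprMn -exprM; congr (_ * _ ^+ _); rewrite [RHS]mulnC !mulnA.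
have eD : delta F Y / (2 * Y) <= D / m%:R.
  rewrite YE ler_pM2r ?invr_gt0//; apply: delta_le => //; first exact: ltW.
  by rewrite /Y ler_pM2r ?invr_gt0// ler_nat.
apply: (@le_trans _ _ ((D / m%:R) ^+ 2)); first by rewrite lerXn2r ?nnegrE// divr_ge0// ltW.
have NE : N = m%:R + 1 by rewrite /N -natr1.
have m1 : 1 <= m%:R :> R by rewrite ler1n.
(* It remains to see (m + 1)^3 <= (m + 7) m^2, an equality at m = 1; hence the 6. *)
rewrite (_ : (1 + 6 / N) * (D / N) ^+ 2 = D ^+ 2 * ((N + 6) / N ^+ 3)); last first.
  by field; rewrite gt_eqF.
rewrite (_ : (D / m%:R) ^+ 2 = D ^+ 2 * (m%:R ^+ 2)^-1); last by field; rewrite gt_eqF.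
apply: ler_wpM2l; first exact: sqr_ge0.
rewrite ler_pdivlMr ?exprn_gt0// mulrC ler_pdivrMr ?exprn_gt0//.
by rewrite NE; set M : R := m%:R in m1 *; nra.
Qed.

(** With N = m + 1, the fourth-order bound times N^2 / 4 is 1024 D^2 E^2 / (q^4 N^2); taking out D^2
    / (2N) leaves the constant 2048. *)
Lemma opnorm_total (k m : nat) : (0 < k)%N -> 
  opnorm_le T (delta F (m.+1%:R / 2) ^+ 2 / (2 * m.+1%:R) *
     (1 + 6 / m.+1%:R + 2048 * delta F (m.+1%:R * q) ^+ 2 / (q ^+ 4 * m.+1%:R)))
    ('X ^+ m.+1 - lazy_poly R (4 * k) ^+ (4 * k * m.+1)).
Proof.
move=> k0; have K0 : (0 < 4 * k)%N by rewrite muln_gt0.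
have N0 : 0 < m.+1%:R :> R by rewrite ltr0n.
have /andP[q0 _] := q01.
have := opnorm_subX_lazy_poly lT bT K0 (opnorm_main m k0)
  (fun j jm => opnorm_fourth F_lattice F_sym q01 k0 jm).
set N : R := m.+1%:R; set D := delta F (N / 2); set E := delta F (N * q) => H.
apply: opnormW (H _ _).
- rewrite le_eqVlt; apply/orP; left; apply/eqP; field.
  by rewrite !gt_eqF.
- by rewrite mulr_ge0 ?sqr_ge0// addr_ge0// divr_ge0// ltW.
- apply: divr_ge0; last by apply: mulr_ge0; apply: exprn_ge0; exact: ltW.
  by apply: mulr_ge0; [apply: mulr_ge0; [exact: ler0n|exact: sqr_ge0]|exact: sqr_ge0].
Qed.

End main_bound.

Theorem theorem1 (R : realType) :
  exists2 C : R, 0 < C &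
  forall (d : nat) (F : probability 'rV[R]_d R),
    (0 < d)%N ->
    msupp F `<=` @int_lattice R d ->
    (forall x : 'rV[R]_d, int_lattice x -> F [set x] = F [set - x]) ->
    let q := fine (F [set 0]) in
    0 < q < 1 ->
    forall n : nat, (0 < n)%N ->
    (dTV (convpow (charge_of_finite_measure F) n)
         (conv_exp (cscale n%:R
            (cadd (charge_of_finite_measure F) (copp (@unit_mass R d)))))
     <= (delta F (n%:R / 2) ^+ 2 / (4 * n%:R)
           * (1 + C * (delta F (n%:R * q) + 1) / (q ^+ 4 * Num.sqrt n%:R))
         + C * (1 - q) `^ (9 / 2) / (q ^+ 5 * n%:R * Num.sqrt n%:R))%:E)%E.
Proof.
(* The constant of [opnorm_total], hidden behind an equation so that it unfolds only on demand. *)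
have [C CE] : exists C : R, C = 2048 by exists 2048.
have C0 : 0 < C by rewrite CE ltr0n.
exists C => //.
move=> d F _ FL Fs q q01 [//|m] n0.
have /andP[q0 q1] := q01.
set N : R := m.+1%:R; set s := Num.sqrt N.
have N1 : 1 <= N by rewrite ler1n.
have N0 : 0 < N by rewrite ltr0n.
have s0 : 0 < s by rewrite sqrtr_gt0.
have sN : s ^+ 2 = N by rewrite sqr_sqrtr// ltW.
have s1 : 1 <= s by rewrite -sqrtr1 ler_sqrt.
set D := delta F (N / 2); set E := delta F (N * q).
have D0 : 0 <= D by rewrite delta_ge0// divr_ge0// ltW.
have E0 : 0 <= E by rewrite delta_ge0// mulr_ge0// ltW.
have Q4 : q ^+ 4 <= 1 by rewrite exprn_ile1// ltW.
have Q0 : 0 < q ^+ 4 by rewrite exprn_gt0.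
have last0 : 0 <= C * (1 - q) `^ (9 / 2) / (q ^+ 5 * N * s).
  by rewrite divr_ge0 ?mulr_ge0 ?powR_ge0 ?exprn_ge0// ltW.
apply: (@le_trans _ _ (D ^+ 2 / (4 * N) * (1 + C * (E + 1) / (q ^+ 4 * s)))%:E); last first.
  by rewrite lee_fin lerDl.
(* If E <= s, then E^2 <= E s turns E^2 / N into E / s, and C s absorbs the 6. *)
have [Es|sE] := leP E s.
  apply: le_trans (dTV_convpow_exp_le _ (fun k k0 => opnorm_total FL Fs q01 m k0)) _ => //.
  rewrite lee_fin -/N -/D -/E -/q -CE.
  rewrite (_ : D ^+ 2 / (2 * N) * _ / 2 =
     D ^+ 2 / (4 * N) * (1 + 6 / N + C * E ^+ 2 / (q ^+ 4 * N))); last first.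
    by field; rewrite !gt_eqF.
  apply: ler_wpM2l; first by rewrite divr_ge0 ?sqr_ge0// mulr_ge0// ltW.
  rewrite -addrA lerD2l.
  rewrite -sN (_ : 6 / s ^+ 2 + _ = (6 * q ^+ 4 + C * E ^+ 2) / s / (q ^+ 4 * s)); last first.
    by field; rewrite !gt_eqF.
  rewrite ler_pM2r ?invr_gt0 ?mulr_gt0// ler_pdivrMr//.
  have : E ^+ 2 <= E * s by rewrite expr2 ler_wpM2l.
  by rewrite CE; nra.
(* If E > s, the distance is at most 1, while D >= E/2 makes the prefactor at least 1/16 and the
   bracket is at least 1 + C. *)
apply: le_trans (dTV_convpow_exp_le (c := 2) _ _) _ => // [k k0|].
  apply: opnorm_lazy_diff_le2; rewrite ?muln_gt0//.
rewrite lee_fin divff//.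
have ED : E <= 2 * D.
  apply: (@le_trans _ _ (delta F N)).
    apply: delta_le => //; first by rewrite mulr_ge0// ltW.
    by rewrite ler_piMr// ltW.
  rewrite (_ : N = 2 * (N / 2)); last by field.
  by apply: delta_scale_le => //; rewrite ?ler1n// divr_ge0// ltW.
have D1 : 1 / 16 <= D ^+ 2 / (4 * N).
  rewrite ler_pdivlMr ?mulr_gt0// -sN; nra.
have C1 : C <= C * (E + 1) / (q ^+ 4 * s).
  by rewrite ler_pdivlMr ?mulr_gt0//; nra.
apply: (@le_trans _ _ (1 / 16 * (1 + C))); first by rewrite CE; lra.
by apply: ler_pM; [lra|rewrite addr_ge0// ltW|exact: D1|rewrite lerD2l].
Qed.
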